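(* Let $K\subset\mathbb{R}^d$ be a measurable set with non-empty interior, let $\rho\colon K\to[0,\infty)$ be Lebesgue-integrable with $\int_K\rho(x)\,\mathrm{d}x>0$, and let $\pi$ be the probability measure on $K$ given by $\pi(A)=\int_A\rho(x)\,\mathrm{d}x\big/\int_K\rho(x)\,\mathrm{d}x$. Then the Markov operator $H$ of the hit-and-run algorithm, defined for $f\in L_2(\pi)$ by $$Hf(x)=\frac{1}{\kappa_d}\int_{S^{d-1}}\frac{1}{\ell(x,\theta)}\int_{L(x,\theta)}f(y)\,\rho(y)\,\mathrm{d}y\,\mathrm{d}\theta ,$$ is a positive operator on $L_2(\pi)$.
   Context: $L_2(\pi)$ is the real Hilbert space of ($\pi$-a.e. equivalence classes of) $\pi$-square-integrable functions $f\colon K\to\mathbb{R}$ with inner product $\langle f,g\rangle=\int_K f(x)g(x)\,\mathrm{d}\pi(x)$. A self-adjoint operator $P$ on $L_2(\pi)$ is called positive if $\langle Pf,f\rangle\ge 0$ for all $f\in L_2(\pi)$. $S^{d-1}$ is the Euclidean unit sphere in $\mathbb{R}^d$, $\mathrm{d}\theta$ denotes integration with respect to its surface measure, and $\kappa_d$ is the total surface measure of $S^{d-1}$ (so $\mathrm{d}\theta/\kappa_d$ is the uniform probability distribution on $S^{d-1}$). For $x\in K$ and $\theta\in S^{d-1}$, the chord through $x$ in direction $\theta$ is $L(x,\theta)=\{x+s\theta\in K\mid s\in\mathbb{R}\}$, and its total weight is $\ell(x,\theta)=\int_{L(x,\theta)}\rho(y)\,\mathrm{d}y$, where integrals over $L(x,\theta)$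 are with respect to one-dimensional Lebesgue measure on the line. For $\pi$-a.e. $x$ and a.e. $\theta$ one has $0<\ell(x,\theta)<\infty$, and $Hf$ is understood as defined $\pi$-almost everywhere. *)

(* Defs.v *)
From HB Require Import structures.
From mathcomp Require Import all_boot all_order all_algebra.
From mathcomp Require Import all_classical all_reals all_analysis.
From mathcomp Require Import measurable_realfun.
Import Order.TTheory GRing.Theory Num.Theory.
Import numFieldNormedType.Exports.

Set Implicit Arguments.
Unset Strict Implicit.
Unset Printing Implicit Defensive.

Local Open Scope classical_set_scope.
Local Open Scope ring_scope.

Definition rV_display : measure_display.
Proof. exact: default_measure_display. Qed.

(* Row vectors carry the sigma-algebra generated by the coordinates, i.e. the
   Borel sigma-algebra of R^n. *)
Section measurable_rV.
Context (R : realType) (n : nat).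

Let coor (i : 'I_n) (x : 'rV[R]_n) : measurableTypeR R := x ord0 i.

Let rV_set0 : g_sigma_preimage coor set0.
Proof. exact: sigma_algebra0. Qed.

Let rV_setC A : g_sigma_preimage coor A -> g_sigma_preimage coor (~` A).
Proof. exact: sigma_algebraC. Qed.

Let rV_bigcup (F : (set 'rV[R]_n)^nat) :
  (forall i, g_sigma_preimage coor (F i)) ->
  g_sigma_preimage coor (\bigcup_i (F i)).
Proof. exact: sigma_algebra_bigcup. Qed.

HB.instance Definition _ := @isMeasurable.Build rV_display
  'rV[R]_n (g_sigma_preimage coor) rV_set0 rV_setC rV_bigcup.

End measurable_rV.

Section measurable_rV_lemmas.
Context (R : realType).

Lemma measurable_coord n (i : 'I_n) :
  measurable_fun [set: 'rV[R]_n] (fun x => x ord0 i : measurableTypeR R).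
Proof.
move=> _ Y mY; rewrite setTI; apply: sub_sigma_algebra => /=.
rewrite -bigcup_seq/=; exists i => /=; first by rewrite mem_index_enum.
by exists Y => //; rewrite setTI.
Qed.

Lemma measurable_fun_rV d (T : measurableType d) n (f : T -> 'rV[R]_n) :
  (forall i, measurable_fun [set: T] (fun t => f t ord0 i : measurableTypeR R)) ->
  measurable_fun [set: T] f.
Proof.
move=> mf.
have sub : g_sigma_preimage (fun (i : 'I_n) t => f t ord0 i : measurableTypeR R)
    `<=` measurable.
  apply: smallest_sub; first exact: sigma_algebra_measurable.
  case: n => [|n] in f mf *; first by rewrite big_ord0.
  rewrite -bigcup_mkord_ord; apply: bigcup_sub => i Ii.
  by move=> A [B mB <-]; exact: mf.
move=> _ A mA; rewrite setTI; apply: sub.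
rewrite (g_sigma_preimage_comp
  (fun (i : 'I_n) (x : 'rV[R]_n) => x ord0 i : measurableTypeR R) f).
by exists A => //; rewrite setTI.
Qed.

Lemma measurable_row_mx n :
  measurable_fun [set: measurableTypeR R * 'rV[R]_n]
    (fun p => row_mx (p.1)%:M p.2 : 'rV[R]_n.+1).
Proof.
apply: measurable_fun_rV => i; case: (split_ordP (i : 'I_(1 + n))) => j ->.
  rewrite (_ : (fun _ => _) = fst); first exact: measurable_fst.
  apply/funext => p /=; transitivity (((p.1)%:M : 'M[R]_1) ord0 j).
    exact: row_mxEl.
  by rewrite mxE (ord1 j).
rewrite (_ : (fun _ => _) = fun p : _ * 'rV[R]_n => p.2 ord0 j); last first.
  by apply/funext => p /=; exact: row_mxEr.
exact: (measurableT_comp (measurable_coord j) measurable_snd).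
Qed.

Lemma measurable_rsubmx n :
  measurable_fun [set: 'rV[R]_n.+1]
    (fun x => (x ord0 ord0 : measurableTypeR R, @rsubmx R 1 1 n x)).
Proof.
apply/measurable_fun_pairP; split; first exact: measurable_coord.
apply: measurable_fun_rV => i /=.
rewrite (_ : (fun _ => _) = fun x : 'rV[R]_n.+1 => x ord0 (rshift 1 i)).
  exact: measurable_coord.
by apply/funext => x /=; rewrite mxE.
Qed.

Lemma pushforward_sigma_finite d1 d2 (T1 : measurableType d1)
    (T2 : measurableType d2) (mu : set T1 -> \bar R)
    (f : T1 -> T2) (g : T2 -> T1) :
  measurable_fun setT g -> cancel f g ->
  sigma_finite setT mu -> sigma_finite setT (pushforward mu f).
Proof.
move=> mg fK [F FT Ffin].
exists (fun i => g @^-1` F i).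
  by rewrite -preimage_bigcup -FT preimage_setT.
move=> i; have [mF Foo] := Ffin i; split.
  by rewrite -[X in measurable X]setTI; exact: mg.
rewrite /pushforward -comp_preimage (_ : g \o f = id) ?preimage_id//.
by apply/funext => x /=; rewrite fK.
Qed.

Lemma product_sigma_finite d1 d2 (T1 : measurableType d1)
    (T2 : measurableType d2) (m1 : {sigma_finite_measure set T1 -> \bar R})
    (m2 : {sigma_finite_measure set T2 -> \bar R}) :
  sigma_finite setT (m1 \x m2)%E.
Proof.
have /sigma_finiteP[F [TF ndF Foo]] := sigma_finiteT m1.
have /sigma_finiteP[G [TG ndG Goo]] := sigma_finiteT m2.
exists (fun n => F n `*` G n).
 rewrite -setXTT TF TG predeqE => -[x y]; split.
    move=> [/= [n _ Fnx] [k _ Gky]]; exists (maxn n k) => //; split.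
    - by move: x Fnx; exact/subsetPset/ndF/leq_maxl.
    - by move: y Gky; exact/subsetPset/ndG/leq_maxr.
  by move=> [n _ []/= ? ?]; split; exists n.
move=> k; have [? ?] := Foo k; have [? ?] := Goo k.
split; first exact: measurableX.
by rewrite product_measure1E// lte_mul_pinfty// ge0_fin_numE.
Qed.

End measurable_rV_lemmas.

Section product_lebesgue_step.
Context (R : realType) (n : nat).
Variable mu : {sigma_finite_measure set 'rV[R]_n -> \bar R}.

Let cons_rV (p : measurableTypeR R * 'rV[R]_n) : 'rV[R]_n.+1 :=
  row_mx (p.1)%:M p.2.

HB.instance Definition _ := @isMeasurableFun.Build _ _ _ _ cons_rV
  (@measurable_row_mx R n).

Definition lebesgue_step : set 'rV[R]_n.+1 -> \bar R :=
  pushforward (@lebesgue_measure R \x mu)%E cons_rV.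

Let lebesgue_step0 : lebesgue_step set0 = 0%E.
Proof. exact: measure0. Qed.

Let lebesgue_step_ge0 A : (0 <= lebesgue_step A)%E.
Proof. exact: measure_ge0. Qed.

Let lebesgue_step_semi_sigma_additive : semi_sigma_additive lebesgue_step.
Proof. exact: measure_semi_sigma_additive. Qed.

HB.instance Definition _ := isMeasure.Build _ _ _ lebesgue_step
  lebesgue_step0 lebesgue_step_ge0 lebesgue_step_semi_sigma_additive.

Let lebesgue_step_sigma_finite : sigma_finite setT lebesgue_step.
Proof.
apply: (pushforward_sigma_finite (@measurable_rsubmx R n)); last first.
  exact: product_sigma_finite.
move=> -[a x].
rewrite /cons_rV /= row_mxKr; congr pair.
transitivity ((a%:M : 'M[R]_1) ord0 ord0); last by rewrite mxE.
by rewrite -[RHS](row_mxEl _ x); congr (row_mx _ _ _ _); exact: val_inj.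
Qed.

HB.instance Definition _ := @Measure_isSigmaFinite.Build _ _ _
  lebesgue_step lebesgue_step_sigma_finite.

End product_lebesgue_step.


(* n-dimensional Lebesgue measure on the Borel sets: the n-fold product of the
   one-dimensional one. *)
Fixpoint borel_lebesgue (R : realType) (n : nat) :
    {sigma_finite_measure set 'rV[R]_n -> \bar R} :=
  match n with
  | 0%N => dirac (0 : 'rV[R]_0)
  | m.+1 => lebesgue_step (borel_lebesgue R m)
  end.

(* R^n with the sigma-algebra of Lebesgue-measurable sets; as a type it is
   convertible to 'rV[R]_n. *)
Notation lebesgue_rV R n :=
  (caratheodory_type (mu_ext (borel_lebesgue R n))).

Definition lebesgue (R : realType) (n : nat) :
  set (lebesgue_rV R n) -> \bar R :=
  @completed_measure_extension _ _ _ (borel_lebesgue R n).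

HB.instance Definition _ (R : realType) (n : nat) :=
  Measure.on (@lebesgue R n).

Definition enorm (R : realType) (n : nat) (x : 'rV[R]_n) : R :=
  Num.sqrt (\sum_(i < n) x ord0 i ^+ 2).

Definition esphere (R : realType) (n : nat) : set 'rV[R]_n :=
  [set x | enorm x = 1].

Definition punctured_ball (R : realType) (n : nat) : set 'rV[R]_n :=
  [set x | 0 < enorm x <= 1].

Section surface_measure.
Context (R : realType) (n : nat).

Lemma measurable_enorm :
  measurable_fun [set: 'rV[R]_n] (@enorm R n : _ -> measurableTypeR R).
Proof.
rewrite (_ : @enorm R n = fun x => (\sum_(i < n) x ord0 i ^+ 2) `^ (2^-1)).
  apply: (@measurableT_comp _ _ _ _ _ _ (@powR R ^~ 2^-1) _
    (fun x : 'rV[R]_n => \sum_(i < n) x ord0 i ^+ 2)) => //.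
  apply: measurable_sum => i; apply: measurable_funX; exact: measurable_coord.
by apply/funext => x; rewrite powR12_sqrt// sumr_ge0// => i _; rewrite sqr_ge0.
Qed.

Lemma measurable_punctured_ball : measurable (@punctured_ball R n).
Proof.
rewrite (_ : @punctured_ball R n = @enorm R n @^-1` `]0, 1]).
  by rewrite -[X in measurable X]setTI; exact: measurable_enorm.
by apply/seteqP; split => x /=; rewrite in_itv.
Qed.

Let normalize (x : 'rV[R]_n) : 'rV[R]_n := (enorm x)^-1 *: x.

Let measurable_normalize : measurable_fun setT normalize.
Proof.
apply: measurable_fun_rV => i.
rewrite (_ : (fun _ => _) = fun x : 'rV[R]_n => enorm x `^ (-1) * x ord0 i).
  apply: measurable_funM; last exact: measurable_coord.
  apply: (@measurableT_comp _ _ _ _ _ _ (@powR R ^~ (-1)) _ (@enorm R n)) => //.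
  exact: measurable_enorm.
by apply/funext => x; rewrite mxE powR_inv1// sqrtr_ge0.
Qed.

HB.instance Definition _ :=
  @isMeasurableFun.Build _ _ _ _ normalize measurable_normalize.

Definition cone_volume : set 'rV[R]_n -> \bar R :=
  pushforward (mrestr (borel_lebesgue R n) measurable_punctured_ball) normalize.

Let cone_volume0 : cone_volume set0 = 0%E.
Proof. exact: measure0. Qed.

Let cone_volume_ge0 A : (0 <= cone_volume A)%E.
Proof. exact: measure_ge0. Qed.

Let cone_volume_semi_sigma_additive : semi_sigma_additive cone_volume.
Proof. exact: measure_semi_sigma_additive. Qed.

HB.instance Definition _ := isMeasure.Build _ _ _ cone_volume
  cone_volume0 cone_volume_ge0 cone_volume_semi_sigma_additive.

(* The surface measure of a Borel part A of the unit sphere is n times the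
   volume of the cone { r *: theta | theta \in A, 0 < r <= 1 }. *)
Definition borel_surface : set 'rV[R]_n -> \bar R :=
  mscale n%:R%:nng cone_volume.

HB.instance Definition _ := Measure.on borel_surface.

Definition surface :
  set (caratheodory_type (mu_ext borel_surface)) -> \bar R :=
  @completed_measure_extension _ _ _ borel_surface.

HB.instance Definition _ := Measure.on surface.

End surface_measure.
Arguments surface {R n}.
Arguments lebesgue {R n}.
Arguments esphere R n : clear implicits.

Section hit_and_run.
Context (R : realType) (n : nat) (K : set 'rV[R]_n) (rho : 'rV[R]_n -> R).
Implicit Types (x theta : 'rV[R]_n) (f : 'rV[R]_n -> R).

(* The chord L(x, theta), read through the parametrization s |-> x + s theta of
   the line. It is an isometry when theta is a unit vector, so one-dimensional
   Lebesgue measure on the line is Lebesgue measure in s. *)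
Definition chord x theta : set R := [set s | K (x + s *: theta)].

Definition chord_weight x theta : \bar R :=
  \int[completed_lebesgue_measure]_(s in chord x theta)
    (rho (x + (s : R) *: theta))%:E.

(* Total by the usual conventions (fine +oo = 0, 0^-1 = 0, integrals of
   non-integrable functions), which only matter on null sets. *)
Definition hit_and_run f x : R :=
  (fine (surface (esphere R n)))^-1 *
  \int[surface]_(theta in esphere R n)
    ((fine (chord_weight x theta))^-1 *
     \int[completed_lebesgue_measure]_(s in chord x theta)
       (f (x + (s : R) *: theta) * rho (x + (s : R) *: theta))).

End hit_and_run.

(* Operators on L_2(mu) as maps on representatives; the second condition of
   bounded_operator says that they act on a.e. equivalence classes. *)
Section L2_operators.
Context d (T : measurableType d) (R : realType).
Variables (mu : {measure set T -> \bar R}) (P : (T -> R) -> T -> R).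
Local Notation L2 := (Lfun mu 2%:E).

Definition L2_inner (f g : T -> R) : R := \int[mu]_x (f x * g x).

Definition bounded_operator : Prop :=
  [/\ {in L2, forall f, P f \in L2},
      {in L2 &, forall f g, f = g %[ae mu] -> P f = P g %[ae mu]},
      forall a : R,
        {in L2 &, forall f g,
          P (fun x => a * f x + g x) = (fun x => a * P f x + P g x) %[ae mu]} &
      exists C : R, {in L2, forall f,
        ('N[mu]_2%:E [EFin \o P f] <= C%:E * 'N[mu]_2%:E [EFin \o f])%E}].

Definition self_adjoint_operator : Prop :=
  bounded_operator /\
  {in L2 &, forall f g, L2_inner (P f) g = L2_inner f (P g)}.

Definition positive_operator : Prop :=
  self_adjoint_operator /\ {in L2, forall f, 0 <= L2_inner (P f) f}.

End L2_operators.

(* Main.v *)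
(* For a direction th, let m_th a (x) be the rho-weighted mean of a over the chord
   through x in direction th. It is constant along that chord, so inserting the mean of
   the constant 1 and translating along the chord gives
     \int b rho (m_th a) = \int rho (m_th a) (m_th b),
   which is symmetric in a and b and nonnegative for a = b; integrating over th yields
   symmetry and positivity, and the Cauchy-Schwarz inequality (m_th a)^2 <= m_th (a^2)
   together with symmetry against the constant 1 gives the L2 contraction bound. All
   this is done by Tonelli for nonnegative Borel functions; a Lebesgue measurable
   function agrees with a Borel one off a Borel null set N, and almost every chord
   through almost every point meets N in a null set. *)

From HB Require Import structures.
Require Import Defs.
From mathcomp Require Import all_boot all_order all_algebra.
From mathcomp Require Import all_classical all_reals all_analysis.
From mathcomp Require Import measurable_realfun ring lra.
Import Order.TTheory GRing.Theory Num.Theory.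
Import numFieldNormedType.Exports.

Set Implicit Arguments.
Unset Strict Implicit.
Unset Printing Implicit Defensive.

Local Open Scope classical_set_scope.
Local Open Scope ring_scope.

(** Tonelli applies to nonnegative integrands, so for a signed function the form is never written as
    the integral of a square. It is expanded into four forms of positive and negative parts, and its
    positivity is the subtraction-free inequality 2 m(u) m(v) <= m(u)^2 + m(v)^2, integrated over
    points and directions. Differences are taken only after all forms are known to be finite. That
    finiteness rests on the square bound: [k] times the squared direction mean of |g| is integrable.
    The bound also gives linearity of the averaged operator, though only almost everywhere on the
    set where the density is nonzero, which is all that [pi] sees. On a chord of zero or infinite
    weight the mean of 1 is 0 and not 1. Every mean over such a chord is then 0 as well, so the
    chord identities remain true in all directions. *)

Lemma measure0_bigcup d (T : measurableType d) (R : realType)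
    (m : {measure set T -> \bar R}) (N : (set T)^nat) :
  (forall i, measurable (N i)) -> (forall i, m (N i) = 0%E) ->
  m (\bigcup_i N i) = 0%E.
Proof.
move=> mN N0; apply/eqP; rewrite eq_le measure_ge0 andbT.
apply: (@le_trans _ _ (\sum_(0 <= i <oo) m (N i))%E).
  by apply: measure_sigma_subadditive => //; exact: bigcupT_measurable.
by rewrite eseries0.
Qed.

(** * Completion of a measure: Borel versions of sets and functions *)

Section completion.
Local Open Scope ereal_scope.
Context d (T : measurableType d) (R : realType).
Variable m : {measure set T -> \bar R}.

Let cT : measurableType _ := caratheodory_type (mu_ext m).
Let cm : {measure set cT -> \bar R} := @completed_measure_extension _ _ _ m.

Lemma measurable_id_completion :
  measurable_fun [set: cT] (id : cT -> T).
Proof.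
by move=> _ A mA; rewrite setTI; exact: caratheodory_measurable_mu_ext.
Qed.

Lemma completed_measure_extensionE (A : set T) :
  measurable A -> cm A = m A.
Proof. by move=> mA; rewrite /cm/= /completed_measure_extension measurable_mu_extE. Qed.

Lemma completed_measure_extension_complete : measure_is_complete cm.
Proof. exact: measure_is_complete_caratheodory. Qed.

(** Countable covers whose total mass exceeds the outer measure by less than 1/(n+1) are intersected
    over n; for infinite outer measure the whole space serves. *)
Lemma measurable_hull (X : set T) :
  exists F, [/\ measurable F, X `<=` F & mu_ext m X = m F].
Proof.
have [Xoo|] := eqVneq (mu_ext m X) +oo.
  exists setT; split => //; apply/esym/eqP; rewrite Xoo -leye_eq -Xoo.
  by rewrite -(measurable_mu_extE m)// le_outer_measure.
rewrite -ltey => Xoo.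
have coverX n : exists A : (set T)^nat, measurable_cover X A /\
    \sum_(0 <= k <oo) m (A k) < mu_ext m X + (n.+1%:R^-1)%:E.
  have : mu_ext m X \is a fin_num by rewrite ge0_fin_numE// mu_ext_ge0.
  have n0 : (0 < n.+1%:R^-1 :> R)%R by rewrite invr_gt0.
  by move/lb_ereal_inf_adherent => /(_ _ n0)[_/= [A EA] <-] ?; exists A.
pose A n := projT1 (cid (coverX n)).
have cA n : measurable_cover X (A n) by rewrite /A; case: cid => ? [].
have sA n : \sum_(0 <= k <oo) m (A n k) < mu_ext m X + (n.+1%:R^-1)%:E.
  by rewrite /A; case: cid => ? [].
have mA n : measurable (\bigcup_k A n k).
  by apply: bigcupT_measurable => k; case: (cA n) => /(_ k).
pose F := \bigcap_n \bigcup_k A n k.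
have mF : measurable F by exact: bigcapT_measurable.
have XF : X `<=` F by apply: sub_bigcap => n _; case: (cA n).
exists F; split => //; apply/eqP; rewrite eq_le.
rewrite -(measurable_mu_extE m)// le_outer_measure//=.
apply/lee_addgt0Pr => _/posnumP[e]; near \oo => n.
apply: (@le_trans _ _ (mu_ext m (\bigcup_k A n k))).
  by apply: le_outer_measure; exact: bigcap_inf.
apply: (@le_trans _ _ (mu_ext m X + (n.+1%:R^-1)%:E)).
  apply: le_trans (ltW (sA n)).
  apply: (le_trans (outer_measure_sigma_subadditive (mu_ext m) (A n))).
  apply: lee_nneseries => // k _.
  by rewrite -[leRHS]measurable_mu_extE//; case: (cA n) => /(_ k).
rewrite leeD// lee_fin ltW//.
by near: n; apply: near_infty_natSinv_lt.
Unshelve. all: by end_near. Qed.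

Hypothesis sfm : sigma_finite setT m.

(** For a set [A] of finite measure take a Borel hull [F] of [A] and a Borel hull [G] of [F] minus
    [A]. Then [G] is null because [A] and [F] have the same finite measure, and [A] minus [G] equals
    [F] minus [G]. A sigma-finite exhaustion reduces the general case to this one. *)
Lemma completion_setD_null (E : set cT) : measurable E ->
  exists N : set T, [/\ measurable N, m N = 0 & measurable (E `\` N : set T)].
Proof.
have fin (A : set cT) : measurable A -> cm A < +oo ->
    exists N : set T, [/\ measurable N, m N = 0 & measurable (A `\` N : set T)].
  move=> mA Aoo.
  have [F [mF AF AFE]] := measurable_hull A.
  have [G [mG FAG FAGE]] := measurable_hull (F `\` A).
  have cF : measurable (F : set cT) by exact: caratheodory_measurable_mu_ext.
  exists G; split => //.
    rewrite -FAGE -[LHS]/(cm (F `\` A)) measureD//=.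
      rewrite setIidr// /completed_measure_extension measurable_mu_extE// -AFE.
      by rewrite subee// ge0_fin_numE// mu_ext_ge0.
    by rewrite /completed_measure_extension measurable_mu_extE// -AFE.
  rewrite (_ : _ `\` _ = F `\` G); first exact: measurableD.
  apply/seteqP; split => x [? nG]; split => //; first exact: AF.
  by apply: contrapT => nA; apply: nG; exact: FAG.
move=> mE; have [S ST mS] := sfm.
have cS i : measurable (S i : set cT).
  by apply: caratheodory_measurable_mu_ext; case: (mS i).
have ES i : exists N : set T,
    [/\ measurable N, m N = 0 & measurable ((E `&` S i) `\` N : set T)].
  apply: fin; first exact: measurableI.
  apply: (@le_lt_trans _ _ (cm (S i))).
    by apply: le_measure; rewrite ?inE//; exact: measurableI.
  by rewrite /= completed_measure_extensionE//; case: (mS i).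
pose N i := projT1 (cid (ES i)).
have [mN N0 mEN] : [/\ forall i, measurable (N i), forall i, m (N i) = 0 &
    forall i, measurable ((E `&` S i) `\` N i : set T)].
  by split=> i; rewrite /N; case: cid => ? [].
have mNN : measurable (\bigcup_i N i) by exact: bigcupT_measurable.
exists (\bigcup_i N i); split => //; first exact: measure0_bigcup.
rewrite (_ : _ `\` _ = (\bigcup_i ((E `&` S i) `\` N i)) `\` (\bigcup_i N i)).
  by apply: measurableD => //; exact: bigcupT_measurable.
apply/seteqP; split => x.
  move=> [Ex nN]; split => //.
  have [i _ Six] : (\bigcup_i S i) x by rewrite -ST.
  by exists i => //; split => // Nx; apply: nN; exists i.
by move=> [[i _ [[]]]].
Qed.

(** Each set [q < f] with q rational becomes Borel after removal of a null set. The union of these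
    null sets is null, and off it every set [a < f] is a countable union of Borel sets. The value 0
    on [N] keeps a version of a nonnegative function nonnegative. *)
Lemma completion_borel_version (f : cT -> R) : measurable_fun setT f ->
  exists (g : T -> R) (N : set T), [/\ measurable_fun setT g,
    measurable N, m N = 0, (forall x, ~ N x -> f x = g x)
    & (forall x, N x -> g x = 0%R)].
Proof.
move=> mf.
have mfq (q : rat) : measurable [set x | (ratr q < f x)%R].
  rewrite (_ : mkset _ = setT `&` f @^-1` `]ratr q, +oo[%classic).
    by apply: mf => //; exact: measurable_itv.
  by apply/seteqP; split => x /=; rewrite in_itv/= andbT => // -[].
(* An enumeration of the rationals; indices that encode none give 0. *)
pose q i : rat := odflt 0%R (unpickle i).
pose N i := projT1 (cid (completion_setD_null (mfq (q i)))).
have [mN N0 mE] : [/\ forall i, measurable (N i), forall i, m (N i) = 0 &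
    forall i, measurable ([set x | (ratr (q i) < f x)%R] `\` N i : set T)].
  by split=> i; rewrite /N; case: cid => ? [].
pose NN := \bigcup_i N i.
have mNN : measurable NN by exact: bigcupT_measurable.
exists (fun x => if x \in NN then 0%R else f x), NN; split => //.
- apply: (measurability _ (RGenOInfty.measurableE R)) => // _ [_ [a ->] <-].
  rewrite setTI.
  (* The exceptional set lies in [a < g] exactly when a is negative, since [g] is 0 on it. *)
  rewrite (_ : _ @^-1` _ = ((\bigcup_(i in [set i | (a <= ratr (q i))%R])
    ([set x | (ratr (q i) < f x)%R] `\` N i)) `\` NN) `|`
    (if (a < 0)%R then NN else set0)).
    apply: measurableU; last by case: ifP.
    by apply: measurableD => //; exact: bigcup_measurable.
  apply/seteqP; split => x /=; rewrite in_itv/= andbT.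
    case: ifPn => [/set_mem xN a0|/negP xN ax]; first by right; rewrite a0.
    have {}xN : ~ NN x by move=> /mem_set.
    left; split => //; have [r] := rat_in_itvoo ax.
    rewrite in_itv/= => /andP[ar rf].
    have qr : q (pickle r) = r by rewrite /q pickleK.
    exists (pickle r) => /=; rewrite qr; first exact: ltW.
    by split => // Nx; apply: xN; exists (pickle r).
  move=> [[[i /= ai [qf _]] xN]|].
    by rewrite memNset//; exact: le_lt_trans ai qf.
  by case: ifPn => // a0 xN; rewrite mem_set.
- exact: measure0_bigcup.
- by move=> x xN; rewrite memNset.
- by move=> x xN; rewrite mem_set.
Qed.

End completion.

(** * Integrals of functions that agree with a Borel one off a Borel null set *)

Section completed_integral.
Local Open Scope ereal_scope.
Context d1 d2 (T1 : measurableType d1) (T2 : measurableType d2) (R : realType).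
Variables (m1 : {measure set T1 -> \bar R}) (m2 : {measure set T2 -> \bar R}).
Variable i : T1 -> T2.
Hypotheses (mi : measurable_fun setT i) (cm1 : measure_is_complete m1).
Hypothesis m1E : forall A, measurable A -> m1 (i @^-1` A) = m2 A.

Variables (phi : T1 -> \bar R) (g : T2 -> \bar R) (N : set T2).
Hypotheses (mg : measurable_fun setT g) (mN : measurable N) (N0 : m2 N = 0).
Hypothesis phiE : forall x, ~ N (i x) -> phi x = g (i x).

(** In every use [i] is the identity, read as a map from a completed sigma-algebra to the Borel one.
    Completeness of [m1] then makes [phi] measurable whatever its values over [N]. *)
Lemma ae_eq_completed : ae_eq m1 setT (g \o i) phi.
Proof.
exists (i @^-1` N); split; rewrite ?m1E//.
  by rewrite -[X in measurable X]setTI; exact: mi.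
by move=> x /= gphi; apply: contrapT => Nx; apply: gphi => _; rewrite phiE.
Qed.

Lemma measurable_fun_completed : measurable_fun setT phi.
Proof.
apply: ae_measurable_fun ae_eq_completed _ => //.
exact: measurableT_comp.
Qed.

Lemma ge0_integral_completed : (forall x, 0 <= phi x) -> (forall x, 0 <= g x) ->
  \int[m1]_x phi x = \int[m2]_x g x.
Proof.
move=> phi0 g0.
pose i' : {mfun T1 >-> T2} :=
  HB.pack i (isMeasurableFun.Build _ _ _ _ i mi).
transitivity (\int[pushforward m1 i']_x g x).
  rewrite ge0_integral_pushforward// preimage_setT.
  apply: ge0_ae_eq_integral => //.
  - exact: measurable_fun_completed.
  - exact: measurableT_comp.
  - by move=> x _; exact: g0.
  - by apply: ae_eq_sym; exact: ae_eq_completed.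
by apply: eq_measure_integral => A mA _; exact: m1E.
Qed.

End completed_integral.

Lemma integral_completed d1 d2 (T1 : measurableType d1)
    (T2 : measurableType d2) (R : realType)
    (m1 : {measure set T1 -> \bar R}) (m2 : {measure set T2 -> \bar R})
    (i : T1 -> T2) (phi : T1 -> \bar R) (g : T2 -> \bar R) (N : set T2) :
  measurable_fun setT i -> measure_is_complete m1 ->
  (forall A, measurable A -> m1 (i @^-1` A) = m2 A) ->
  measurable_fun setT g -> measurable N -> m2 N = 0%E ->
  (forall x, ~ N (i x) -> phi x = g (i x)) ->
  (\int[m1]_x phi x = \int[m2]_x g x)%E.
Proof.
move=> mi cm1 m1E mg mN N0 phiE; rewrite integralE [RHS]integralE.
congr (_ - _)%E.
  apply: (ge0_integral_completed mi cm1 m1E _ mN N0) => //.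
    exact: measurable_funepos.
  by move=> x Nx; rewrite !funeposE phiE.
apply: (ge0_integral_completed mi cm1 m1E _ mN N0) => //.
  exact: measurable_funeneg.
by move=> x Nx; rewrite !funenegE phiE.
Qed.

(** * Integration against a measure with a density *)

Section density.
Local Open Scope ereal_scope.
Context d (T : measurableType d) (R : realType).
Variables (m m' : {measure set T -> \bar R}) (w : T -> R).
Hypotheses (mw : measurable_fun setT w) (w0 : forall x, (0 <= w x)%R).
Hypothesis m'E : forall A, measurable A -> m' A = \int[m]_(x in A) (w x)%:E.

Import HBNNSimple.

(** The density is given only through the values of [m'] on measurable sets. Linearity extends the
    formula to simple functions and monotone convergence to nonnegative ones. *)
Lemma ge0_integral_density (f : T -> \bar R) : measurable_fun setT f ->
  (forall x, 0 <= f x) -> \int[m']_x f x = \int[m]_x (f x * (w x)%:E).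
Proof.
move=> mf f0.
pose h := nnsfun_approx measurableT mf.
have fE x : f x = limn (fun n => (h n x)%:E).
  by apply/esym/cvg_lim => //; exact: cvg_nnsfun_approx.
have nd x : {homo (fun n => h n x) : a b / (a <= b)%N >-> (a <= b)%R}.
  by move=> a b ab; exact/lefP/nd_nnsfun_approx.
have mh n : measurable_fun setT (fun x => (h n x)%:E).
  exact/measurable_EFinP.
transitivity (limn (fun n => \int[m']_x (h n x)%:E)).
  rewrite -monotone_convergence//.
  - by apply: eq_integral => x _; exact: fE.
  - by move=> n x _; rewrite lee_fin.
  - by move=> x _ a b ab; rewrite lee_fin; exact: nd.
transitivity (limn (fun n => \int[m]_x ((h n x)%:E * (w x)%:E))); last first.
  rewrite -monotone_convergence//.
  - apply: eq_integral => x _; apply/cvg_lim => //.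
    by apply: cvgeZr => //; exact: cvg_nnsfun_approx.
  - by move=> n; apply: emeasurable_funM => //; exact/measurable_EFinP.
  - by move=> n x _; rewrite mule_ge0 ?lee_fin.
  - by move=> x _ a b ab; rewrite lee_wpmul2r ?lee_fin//; exact: nd.
congr (limn _); apply/funext => n.
have -> : \int[m']_x (h n x)%:E =
    \sum_(k \in range (h n)) \int[m']_x (k * \1_(h n @^-1` [set k]) x)%:E.
  under eq_integral do rewrite fimfunE -fsumEFin//.
  rewrite ge0_integral_fsum//.
  - by move=> y; exact/measurable_EFinP/measurable_funM.
  - by move=> y x _; rewrite nnfun_muleindic_ge0.
have -> : \int[m]_x ((h n x)%:E * (w x)%:E) =
    \sum_(k \in range (h n))
      \int[m]_x ((k * \1_(h n @^-1` [set k]) x)%:E * (w x)%:E).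
  rewrite -ge0_integral_fsum//; first last.
  - by move=> y x _; rewrite mule_ge0 ?nnfun_muleindic_ge0 ?lee_fin.
  - move=> y; apply: emeasurable_funM; last exact/measurable_EFinP.
    exact/measurable_EFinP/measurable_funM.
  apply: eq_integral => x _; rewrite fimfunE -fsumEFin// ge0_mule_fsuml//.
  by move=> k; rewrite nnfun_muleindic_ge0.
apply: eq_fsbigr => k /[!inE] -[x _ <-].
set A := h n @^-1` _; have mA : measurable A by exact: measurable_sfunP.
under eq_integral do rewrite EFinM.
under [RHS]eq_integral do rewrite EFinM -muleA.
have h0 : 0 <= (h n x)%:E by rewrite lee_fin.
rewrite ge0_integralZl//; last exact/measurable_EFinP.
rewrite ge0_integralZl//; last 2 first.
  - by apply: emeasurable_funM; exact/measurable_EFinP.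
  - by move=> y _; rewrite mule_ge0 ?lee_fin.
rewrite integral_indic// setIT m'E// [in LHS]integral_mkcond.
congr (_ * _); apply: eq_integral => y _.
by rewrite patchE indicE; case: ifPn; rewrite ?mul1e ?mul0e.
Qed.

End density.

Lemma row_mx_scalar_addr (R : pzRingType) n (s : R) (y : 'rV[R]_n)
    (v : 'rV[R]_(1 + n)) :
  row_mx s%:M y + v = row_mx (s + v ord0 ord0)%:M (y + rsubmx v).
Proof.
apply/rowP => i; case: (split_ordP i) => j ->; rewrite mxE ?row_mxEl ?row_mxEr !mxE//.
by rewrite !ord1 !eqxx !mulr1n; congr (_ + v _ _); exact: val_inj.
Qed.

(** * Translations and reflections of Lebesgue measure *)

Section translation.
Local Open Scope ereal_scope.
Context (R : realType).
Local Notation RT := (measurableTypeR R).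
Local Notation lam := (@lebesgue_measure R).

Let measurable_addr (a : R) : measurable_fun setT (fun s : RT => (s + a)%R : RT).
Proof. exact: measurable_funD. Qed.

(** The image of the measure under a translation has the right value on half-open intervals, and
    these determine it. *)
Lemma lebesgue_measure_translate (a : R) (A : set RT) : measurable A ->
  lam ((fun s : R => (s + a)%R) @^-1` A) = lam A.
Proof.
move=> mA.
pose i' : {mfun RT >-> RT} :=
  HB.pack (fun s : RT => (s + a)%R : RT)
    (isMeasurableFun.Build _ _ _ _ _ (measurable_addr a)).
apply/esym/(@lebesgue_measure_unique R (pushforward lam i')) => //.
move=> X [[x y] _ <-].
transitivity (lam `](x - a)%R, (y - a)%R]%classic).
  rewrite !lebesgue_measure_itv/= !lte_fin ltrD2r.
  by case: ifP => // _; rewrite -!EFinB opprB addrA subrK.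
congr (lam _); apply/seteqP.
by split => s /=; rewrite !in_itv/= ltrBlDr lerBrDr.
Qed.

Lemma ge0_integral_lebesgue_translate (f : RT -> \bar R) (a : R) :
  measurable_fun setT f -> (forall s, 0 <= f s) ->
  \int[lam]_s f (s + a)%R = \int[lam]_s f s.
Proof.
move=> mf f0.
pose i' : {mfun RT >-> RT} :=
  HB.pack (fun s : RT => (s + a)%R : RT)
    (isMeasurableFun.Build _ _ _ _ _ (measurable_addr a)).
transitivity (\int[pushforward lam i']_s f s); last first.
  by apply: eq_measure_integral => A mA _; exact: lebesgue_measure_translate.
by rewrite ge0_integral_pushforward.
Qed.

Lemma ge0_integral_lebesgue_opp (f : RT -> \bar R) :
  measurable_fun setT f -> (forall s, 0 <= f s) ->
  \int[lam]_s f (- s)%R = \int[lam]_s f s.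
Proof.
move=> mf f0.
have mN : measurable_fun setT (fun s : RT => (- s)%R : RT) by exact: measurable_funN.
pose i' : {mfun RT >-> RT} :=
  HB.pack (fun s : RT => (- s)%R : RT) (isMeasurableFun.Build _ _ _ _ _ mN).
transitivity (\int[pushforward lam i']_s f s); last first.
  by apply: eq_measure_integral => A mA _; exact: lebesgue_measureN.
by rewrite ge0_integral_pushforward.
Qed.

(** [borel_lebesgue R n.+1] is the image of a product measure under prepending a coordinate, so this
    is a change of variables followed by Tonelli. *)
Lemma ge0_integral_borel_lebesgueS n (f : 'rV[R]_n.+1 -> \bar R) :
  measurable_fun setT f -> (forall x, 0 <= f x) ->
  \int[borel_lebesgue R n.+1]_x f x =
  \int[lam]_s \int[borel_lebesgue R n]_y f (row_mx s%:M y).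
Proof.
move=> mf f0 /=.
pose c : {mfun (RT * 'rV[R]_n)%type >-> 'rV[R]_n.+1} :=
  HB.pack (fun p : (RT * 'rV[R]_n)%type => row_mx (p.1)%:M p.2 : 'rV[R]_n.+1)
    (isMeasurableFun.Build _ _ _ _ _ (@measurable_row_mx R n)).
transitivity (\int[pushforward (lam \x borel_lebesgue R n) c]_x f x).
  exact: eq_measure_integral.
rewrite ge0_integral_pushforward// preimage_setT fubini_tonelli1//.
  exact: measurableT_comp.
by move=> x; exact: f0.
Qed.

Lemma measurable_rV_addr n (v : 'rV[R]_n) :
  measurable_fun [set: 'rV[R]_n] (fun x : 'rV[R]_n => (x + v)%R).
Proof.
apply: measurable_fun_rV => i.
under eq_fun do rewrite mxE.
by apply: measurable_funD => //; exact: measurable_coord.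
Qed.

(** Induction on the dimension: the first coordinate of [v] translates the outer one-dimensional
    integral, and the remaining ones are handled by the induction hypothesis in the inner
    integral. *)
Lemma ge0_integral_borel_lebesgue_translate n (f : 'rV[R]_n -> \bar R)
    (v : 'rV[R]_n) : measurable_fun setT f -> (forall x, 0 <= f x) ->
  \int[borel_lebesgue R n]_x f (x + v)%R = \int[borel_lebesgue R n]_x f x.
Proof.
elim: n f v => [f v mf f0|n IH f v mf f0].
  by apply: eq_integral => x _; congr f; apply/rowP => -[].
rewrite !ge0_integral_borel_lebesgueS//; last first.
  by apply: measurableT_comp => //; exact: measurable_rV_addr.
have mr : measurable_fun setT
    (fun p : RT * 'rV[R]_n => f (row_mx (p.1)%:M p.2 : 'rV[R]_n.+1)).
  by apply: measurableT_comp => //; exact: measurable_row_mx.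
have mF := measurable_fun_fubini_tonelli_F (m2 := borel_lebesgue R n) _ mr
  (fun p => f0 _).
rewrite -[RHS](ge0_integral_lebesgue_translate (v ord0 ord0) mF); last first.
  by move=> s; exact: integral_ge0.
apply: eq_integral => s _.
rewrite /fubini_F /= -[RHS](IH _ (rsubmx (v : 'rV_(1 + n)))) => [||y]//; last first.
  exact: (measurable_fun_pair2 (s + v ord0 ord0 : RT)%R mr).
by apply: eq_integral => y _; congr f; exact: row_mx_scalar_addr.
Qed.

End translation.

(** * The Cauchy-Schwarz inequality with values in [0, +oo] *)

Section cauchy_schwarz.
Local Open Scope ereal_scope.

(** Written without subtraction so that it makes sense for infinite values; for finite ones it is
    the nonnegativity of (x - y)^2. *)
Lemma lee_mulDmule (R : realType) (x y : \bar R) : 0 <= x -> 0 <= y ->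
  x * y + x * y <= x * x + y * y.
Proof.
case: x => [x| |]//; case: y => [y| |]// x0 y0.
- rewrite -!EFinM -!EFinD lee_fin -subr_ge0.
  rewrite (_ : _ - _ = (x - y) ^+ 2)%R ?sqr_ge0//.
  by rewrite sqrrB !expr2 mulr2n; ring.
- by rewrite mulyy addey ?leey// -EFinM.
- by rewrite mulyy addye ?leey// -EFinM.
Qed.

Lemma lee_double (R : realType) (x y : \bar R) : 0 <= x -> 0 <= y ->
  x + x <= y + y -> x <= y.
Proof.
case: x => [x| |]//; case: y => [y| |]// x0 y0; rewrite ?leey//.
by rewrite -!EFinD !lee_fin => xy; lra.
Qed.

Context d (T : measurableType d) (R : realType) (m : {measure set T -> \bar R}).
Variables (w : T -> R) (a : T -> \bar R).
Hypotheses (mw : measurable_fun setT w) (ma : measurable_fun setT a).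
Hypotheses (w0 : forall x, (0 <= w x)%R) (a0 : forall x, 0 <= a x).

(** Integrate 2 a(x) a(y) <= a(x)^2 + a(y)^2 against w(x) w(y) in both variables and cancel the
    factor 2. The iterated integrals factor by pulling out constants, also when these are
    infinite. *)
Lemma integral_cauchy_schwarz :
  (\int[m]_x (a x * (w x)%:E)) * (\int[m]_x (a x * (w x)%:E)) <=
  (\int[m]_x (w x)%:E) * (\int[m]_x (a x * a x * (w x)%:E)).
Proof.
set I := \int[m]_x (a x * (w x)%:E).
set W := \int[m]_x (w x)%:E; set Q := \int[m]_x (a x * a x * (w x)%:E).
have mw' : measurable_fun setT (fun x => (w x)%:E) by exact/measurable_EFinP.
have w0' x : 0 <= (w x)%:E by rewrite lee_fin.
have aw0 x : 0 <= a x * (w x)%:E by rewrite mule_ge0.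
have aaw0 x : 0 <= a x * a x * (w x)%:E by rewrite !mule_ge0.
have maw : measurable_fun setT (fun x => a x * (w x)%:E).
  exact: emeasurable_funM.
have maaw : measurable_fun setT (fun x => a x * a x * (w x)%:E).
  by apply: emeasurable_funM => //; exact: emeasurable_funM.
have I0 : 0 <= I by exact: integral_ge0.
have W0 : 0 <= W by exact: integral_ge0.
have Q0 : 0 <= Q by exact: integral_ge0.
apply: lee_double; rewrite ?mule_ge0//.
(* The inequality after integration in the second variable alone. *)
have pt x : a x * (w x)%:E * I + a x * (w x)%:E * I <=
    a x * a x * (w x)%:E * W + (w x)%:E * Q.
  rewrite -!ge0_integralZl// -!ge0_integralD//.
  - apply: ge0_le_integral => //.
    + by move=> y _; rewrite adde_ge0// mule_ge0.
    + by apply: emeasurable_funD; exact: emeasurable_funM.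
    + by apply: emeasurable_funD; exact: emeasurable_funM.
    + move=> y _.
      rewrite (_ : _ * _ = (a x * a y) * ((w x)%:E * (w y)%:E)); last first.
        by rewrite muleACA.
      rewrite (_ : a x * a x * _ * _ = (a x * a x) * ((w x)%:E * (w y)%:E));
        last by rewrite muleA.
      rewrite (_ : (w x)%:E * (a y * a y * _) = (a y * a y) * ((w x)%:E * (w y)%:E));
        last by rewrite muleCA.
      rewrite -[leLHS]ge0_muleDl ?mule_ge0// -[leRHS]ge0_muleDl ?mule_ge0//.
      apply: lee_wpmul2r; first by rewrite mule_ge0.
      by apply: lee_mulDmule.
  - by move=> y _; rewrite mule_ge0.
  - exact: emeasurable_funM.
  - by move=> y _; rewrite mule_ge0.
  - exact: emeasurable_funM.
  - by move=> y _; rewrite mule_ge0.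
  - exact: emeasurable_funM.
  - by move=> y _; rewrite mule_ge0.
  - exact: emeasurable_funM.
have -> : I * I + I * I =
    \int[m]_x (a x * (w x)%:E * I + a x * (w x)%:E * I).
  rewrite ge0_integralD//; try exact: emeasurable_funM.
    by rewrite ge0_integralZr.
  by move=> y _; rewrite mule_ge0.
  by move=> y _; rewrite mule_ge0.
have -> : W * Q + W * Q =
    \int[m]_x (a x * a x * (w x)%:E * W + (w x)%:E * Q).
  rewrite ge0_integralD//; try exact: emeasurable_funM.
    by rewrite !ge0_integralZr// [X in _ = X + _]muleC.
  by move=> y _; rewrite mule_ge0.
  by move=> y _; rewrite mule_ge0.
apply: ge0_le_integral => //.
- by move=> y _; rewrite adde_ge0// mule_ge0.
- by apply: emeasurable_funD; exact: emeasurable_funM.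
- by apply: emeasurable_funD; exact: emeasurable_funM.
Qed.

End cauchy_schwarz.

(** * Integrals along lines and weighted means over chords *)

Section line_integral.
Local Open Scope ereal_scope.
Context (R : realType) (n : nat).
Local Notation V := 'rV[R]_n.
Local Notation RT := (measurableTypeR R).
Local Notation lam := (@lebesgue_measure R).
Implicit Types (f a b k : V -> R) (x th : V).

Definition line_integral f x th : \bar R := \int[lam]_s (f (x + (s : R) *: th)%R)%:E.

Definition chord_scale k x th : R := (fine (line_integral k x th))^-1.

Definition chord_mean k a x th : \bar R :=
  (chord_scale k x th)%:E * line_integral (a \* k)%R x th.

(** An unfolding equation for the sections in which [line_integral] is opaque; [chord_meanE] serves
    the same purpose. *)
Lemma line_integralE f x th :
  line_integral f x th = \int[lam]_s (f (x + (s : R) *: th)%R)%:E.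
Proof. by []. Qed.

Lemma chord_meanE k a x th : chord_mean k a x th =
  (chord_scale k x th)%:E * line_integral (a \* k)%R x th.
Proof. by []. Qed.

Lemma measurable_lineT :
  measurable_fun setT (fun p : (V * V) * RT => (p.1.1 + (p.2 : R) *: p.1.2)%R : V).
Proof.
apply: measurable_fun_rV => i.
under eq_fun do rewrite !mxE.
apply: measurable_funD.
  apply: (measurableT_comp (measurable_coord i)).
  exact: (measurableT_comp measurable_fst measurable_fst).
apply: measurable_funM => //.
apply: (measurableT_comp (measurable_coord i)).
exact: (measurableT_comp measurable_snd measurable_fst).
Qed.

Lemma measurable_line_fun f x th : measurable_fun setT f ->
  measurable_fun setT (fun s : RT => f (x + (s : R) *: th)%R).
Proof.
move=> mf.
exact: (measurableT_comp mf (measurable_fun_pair2 (x, th) measurable_lineT)).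
Qed.

Lemma measurable_line_integral f : measurable_fun setT f ->
  measurable_fun setT (fun p : V * V => line_integral f p.1 p.2).
Proof.
move=> mf.
have mF : measurable_fun setT
    (fun p : (V * V) * RT => (f (p.1.1 + (p.2 : R) *: p.1.2)%R)%:E).
  by apply/measurable_EFinP; exact: (measurableT_comp mf measurable_lineT).
rewrite (_ : (fun _ => _) = (fun p : V * V =>
   (fubini_F lam (fun q : (V * V) * RT => (f (q.1.1 + (q.2 : R) *: q.1.2)%R)%:E)^\+ p)
   - (fubini_F lam (fun q : (V * V) * RT => (f (q.1.1 + (q.2 : R) *: q.1.2)%R)%:E)^\- p))).
  apply: emeasurable_funB; apply: measurable_fun_fubini_tonelli_F => //.
    exact: measurable_funepos.
  exact: measurable_funeneg.
apply/funext => -[x th]; rewrite /line_integral integralE /fubini_F.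
by congr (_ - _); apply: eq_integral => s _; rewrite ?funeposE ?funenegE.
Qed.

Lemma line_integral_ge0 f x th : (forall y, (0 <= f y)%R) ->
  0 <= line_integral f x th.
Proof. by move=> f0; apply: integral_ge0 => s _; rewrite lee_fin. Qed.

Lemma line_integral_shift f x th (t : R) : measurable_fun setT f ->
  (forall y, (0 <= f y)%R) ->
  line_integral f (x + t *: th)%R th = line_integral f x th.
Proof.
move=> mf f0; rewrite /line_integral.
rewrite -[RHS](@ge0_integral_lebesgue_translate R _ t).
- apply: eq_integral => s _; congr (f _)%:E.
  by rewrite scalerDl addrA addrAC.
- by apply/measurable_EFinP; exact: measurable_line_fun.
- by move=> s; rewrite lee_fin.
Qed.

(** After the translation along the chord in [integral_chord_meanM] the line is traversed backwards;
    this restores its orientation. *)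
Lemma line_integral_opp f x th : measurable_fun setT f ->
  (forall y, (0 <= f y)%R) ->
  \int[lam]_s (f (x - (s : R) *: th)%R)%:E = line_integral f x th.
Proof.
move=> mf f0; rewrite /line_integral -[RHS]ge0_integral_lebesgue_opp.
- by apply: eq_integral => s _; rewrite scaleNr.
- by apply/measurable_EFinP; exact: measurable_line_fun.
- by move=> s; rewrite lee_fin.
Qed.

Lemma chord_scale_ge0 k x th : (forall y, (0 <= k y)%R) ->
  (0 <= chord_scale k x th)%R.
Proof. by move=> k0; rewrite invr_ge0 fine_ge0// line_integral_ge0. Qed.

Lemma measurable_chord_scale k : measurable_fun setT k ->
  (forall y, (0 <= k y)%R) ->
  measurable_fun setT (fun p : V * V => chord_scale k p.1 p.2 : RT).
Proof.
move=> mk k0.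
rewrite (_ : (fun _ => _) =
    fun p : V * V => (fine (line_integral k p.1 p.2) `^ (-1))%R); last first.
  by apply/funext => p; rewrite powR_inv1// fine_ge0// line_integral_ge0.
apply: (@measurableT_comp _ _ _ _ _ _ (@powR R ^~ (-1)%R) _
  (fun p : V * V => fine (line_integral k p.1 p.2))) => //.
by apply: measurableT_comp => //; exact: measurable_line_integral.
Qed.

(* Where the chord has zero or infinite weight, the scale is the junk value 0. *)
Lemma chord_scale_mul k x th : chord_scale k x th != 0%R ->
  (chord_scale k x th)%:E * line_integral k x th = 1.
Proof.
rewrite /chord_scale invr_eq0 => L0.
rewrite -[X in _ * X]fineK; first by rewrite -EFinM mulVf.
by case: (line_integral k x th) L0; rewrite /= ?eqxx.
Qed.

Variable k : V -> R.
Hypotheses (mk : measurable_fun setT k) (k0 : forall y, (0 <= k y)%R).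

Let mM a : measurable_fun setT a -> measurable_fun setT (a \* k)%R.
Proof. by move=> ma; exact: measurable_funM. Qed.

Let M0 a : (forall y, 0 <= a y)%R -> forall y, (0 <= (a \* k) y)%R.
Proof. by move=> a0 y; rewrite mulr_ge0. Qed.

Lemma chord_mean_ge0 a x th : (forall y, (0 <= a y)%R) -> 0 <= chord_mean k a x th.
Proof.
move=> a0; rewrite mule_ge0//; first by rewrite lee_fin chord_scale_ge0.
by apply: line_integral_ge0; exact: M0.
Qed.

Lemma measurable_chord_mean a : measurable_fun setT a ->
  measurable_fun setT (fun p : V * V => chord_mean k a p.1 p.2).
Proof.
move=> ma; apply: emeasurable_funM.
  by apply/measurable_EFinP; exact: measurable_chord_scale.
by apply: measurable_line_integral; exact: mM.
Qed.

Lemma chord_mean_shift a x th (t : R) : measurable_fun setT a ->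
  (forall y, (0 <= a y)%R) ->
  chord_mean k a (x + t *: th)%R th = chord_mean k a x th.
Proof.
move=> ma a0; rewrite /chord_mean /chord_scale !line_integral_shift//.
  exact: mM.
exact: M0.
Qed.

(** The mean is 1, except on a degenerate chord, where it is 0. *)
Lemma chord_mean_cst1 x th : chord_mean k (cst 1%R) x th <= 1.
Proof.
rewrite /chord_mean (_ : _ \* k = k)%R; last by apply/funext => y /=; rewrite mul1r.
have [->|c0] := eqVneq (chord_scale k x th) 0%R; first by rewrite mul0e lee01.
by rewrite chord_scale_mul.
Qed.

(** Cauchy-Schwarz on the chord with weight [k], multiplied by the square of the scale: one of the
    two scale factors cancels the weight of the chord. *)
Lemma chord_mean_sqr a x th : measurable_fun setT a -> (forall y, (0 <= a y)%R) ->
  chord_mean k a x th * chord_mean k a x th <=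
  chord_mean k (fun y => a y ^+ 2)%R x th.
Proof.
move=> ma a0; rewrite /chord_mean.
have [->|c0] := eqVneq (chord_scale k x th) 0%R; first by rewrite !mul0e.
set c := chord_scale k x th; have c0' : 0 <= c%:E by rewrite lee_fin chord_scale_ge0.
have cs : line_integral (a \* k)%R x th * line_integral (a \* k)%R x th <=
    line_integral k x th * line_integral ((fun y => a y ^+ 2) \* k)%R x th.
  apply: (@integral_cauchy_schwarz _ _ _ lam (fun s : RT => k (x + (s : R) *: th)%R)
    (fun s : RT => (a (x + (s : R) *: th)%R)%:E)) => //.
  - exact: measurable_line_fun.
  - by apply/measurable_EFinP; exact: measurable_line_fun.
  - by move=> s; rewrite lee_fin.
rewrite muleACA; apply: (@le_trans _ _ (c%:E * c%:E * (line_integral k x th *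
    line_integral ((fun y => a y ^+ 2) \* k)%R x th))).
  by rewrite lee_wpmul2l// mule_ge0.
by rewrite muleACA chord_scale_mul// mul1e.
Qed.

Local Notation mu := (borel_lebesgue R n).

(* Inserting the mean of the constant 1 over the chord and translating along
   the chord turns the second factor b into its chord mean. *)
Lemma integral_chord_meanM a b th :
  measurable_fun setT a -> (forall y, (0 <= a y)%R) ->
  measurable_fun setT b -> (forall y, (0 <= b y)%R) ->
  \int[mu]_x ((b x * k x)%:E * chord_mean k a x th) =
  \int[mu]_x ((k x)%:E * (chord_mean k a x th * chord_mean k b x th)).
Proof.
move=> ma a0 mb b0.
(* [w] gathers what is constant along the chord: the mean of [a], and the scale that appears when 1
   is written as the scale times the integral of [k]. *)
pose w (x : V) := (chord_scale k x th)%:E * chord_mean k a x th.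
have mcs : measurable_fun setT (fun x : V => (chord_scale k x th)%:E).
  apply/measurable_EFinP.
  exact: (measurable_fun_pair1 th (measurable_chord_scale mk k0)).
have mcm : measurable_fun setT (fun x : V => chord_mean k a x th).
  exact: (measurable_fun_pair1 th (measurable_chord_mean ma)).
have mw : measurable_fun setT w by exact: emeasurable_funM.
have w0 x : 0 <= w x.
  by rewrite mule_ge0 ?chord_mean_ge0// lee_fin chord_scale_ge0.
have bkwk0 (x y z : V) : 0 <= (b x * k x)%:E * w y * (k z)%:E.
  by apply: mule_ge0; [apply: mule_ge0; rewrite ?w0// lee_fin mulr_ge0|rewrite lee_fin].
have wS x t : w (x + t *: th)%R = w x.
  by rewrite /w chord_mean_shift// /chord_scale line_integral_shift.
have mT : measurable_fun setT (fun p : V * RT => p.1 + (p.2 : R) *: th)%R.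
  apply: measurable_fun_rV => i; under eq_fun do rewrite !mxE.
  apply: measurable_funD.
    exact: (measurableT_comp (measurable_coord i) measurable_fst).
  exact: measurable_funM.
have mT' : measurable_fun setT (fun p : V * RT => p.1 - (p.2 : R) *: th)%R.
  apply: measurable_fun_rV => i; under eq_fun do rewrite !mxE.
  apply: measurable_funB.
    exact: (measurableT_comp (measurable_coord i) measurable_fst).
  exact: measurable_funM.
have mw1 : measurable_fun setT (fun p : V * RT => w p.1).
  exact: (measurableT_comp mw measurable_fst).
have m1 f : measurable_fun setT f -> measurable_fun setT (fun p : V * RT => (f p.1)%:E).
  move=> mf; apply/measurable_EFinP.
  exact: (measurableT_comp mf measurable_fst).
transitivity (\int[mu]_x \int[lam]_s
    ((b x * k x)%:E * w x * (k (x + (s : R) *: th)%R)%:E)).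
  apply: eq_integral => x _; rewrite ge0_integralZl//; first last.
  - by rewrite mule_ge0// lee_fin mulr_ge0.
  - by move=> s _; rewrite lee_fin.
  - by apply/measurable_EFinP; exact: measurable_line_fun.
  rewrite -muleA /w -[\int[_]_s _]/(line_integral k x th); congr (_ * _).
  rewrite muleAC [in RHS]/chord_mean.
  (* On a degenerate chord there is no such expression of 1, but both sides are 0. *)
  have [c0|c0] := eqVneq (chord_scale k x th) 0%R.
    by rewrite /chord_mean c0 !mul0e.
  by rewrite chord_scale_mul// mul1e.
rewrite (@fubini_tonelli _ _ _ _ _ mu lam (fun p : V * RT =>
    (b p.1 * k p.1)%:E * w p.1 * (k (p.1 + (p.2 : R) *: th)%R)%:E)); first last.
- by move=> p; exact: bkwk0.
- apply: emeasurable_funM; last first.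
    by apply/measurable_EFinP; exact: measurableT_comp.
  by apply: emeasurable_funM => //; apply: (m1 (b \* k)%R); exact: mM.
(* For each fixed s, translating x by - s th brings the argument of [k] back to x, leaves [w]
   unchanged and shifts the argument of [b \* k] instead. *)
transitivity (\int[lam]_s \int[mu]_x
    (((b \* k)%R (x - (s : R) *: th)%R)%:E * w x * (k x)%:E)).
  apply: eq_integral => s _.
  rewrite -[LHS](@ge0_integral_borel_lebesgue_translate R n _ (- (s *: th))%R).
  - apply: eq_integral => x _ /=.
    by rewrite -scaleNr wS scaleNr subrK.
  - apply: emeasurable_funM; last first.
      apply/measurable_EFinP; apply: (measurableT_comp mk).
      exact: (measurable_fun_pair1 (s : RT) mT).
    by apply: emeasurable_funM => //; apply/measurable_EFinP; exact: mM.
  - by move=> x; exact: bkwk0.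
rewrite -(@fubini_tonelli _ _ _ _ _ mu lam (fun p : V * RT =>
    ((b \* k)%R (p.1 - (p.2 : R) *: th)%R)%:E * w p.1 * (k p.1)%:E)); first last.
- by move=> p; exact: bkwk0.
- apply: emeasurable_funM; last exact: m1.
  apply: emeasurable_funM => //.
  by apply/measurable_EFinP; apply: measurableT_comp mT' => //; exact: mM.
apply: eq_integral => x _ /=.
under eq_integral do rewrite -muleA.
rewrite ge0_integralZr//; first last.
- by rewrite mule_ge0// lee_fin.
- by move=> s _; rewrite lee_fin mulr_ge0.
- apply/measurable_EFinP; apply: (measurableT_comp (mM mb)).
  exact: (measurable_fun_pair2 x mT').
rewrite (line_integral_opp _ _ (mM mb) (M0 b0)) /w [chord_mean k b x th]/chord_mean.
set A := chord_mean k a x th; set L := line_integral _ _ _.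
by rewrite [LHS]muleC [(_ * A) * _]muleC -muleA [_ * A]muleC -muleA.
Qed.

End line_integral.

(** Carries 2 f <= g + h through an integral; it serves once for the integral over directions and
    once for the integral over points. *)
Lemma ge0_le_integralDD d (T : measurableType d) (R : realType)
    (m : {measure set T -> \bar R}) (f g h : T -> \bar R) :
  measurable_fun setT f -> (forall x, 0 <= f x)%E ->
  measurable_fun setT g -> (forall x, 0 <= g x)%E ->
  measurable_fun setT h -> (forall x, 0 <= h x)%E ->
  (forall x, f x + f x <= g x + h x)%E ->
  (\int[m]_x f x + \int[m]_x f x <= \int[m]_x g x + \int[m]_x h x)%E.
Proof.
move=> mf f0 mg g0 mh h0 fgh.
rewrite -(ge0_integralD m measurableT (fun x _ => f0 x) mf (fun x _ => f0 x) mf).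
rewrite -(ge0_integralD m measurableT (fun x _ => g0 x) mg (fun x _ => h0 x) mh).
apply: ge0_le_integral => //.
- by move=> x _; rewrite adde_ge0.
- exact: emeasurable_funD.
- exact: emeasurable_funD.
Qed.

(** * Averages over directions and the associated form on nonnegative functions *)

Section direction_mean.
Local Open Scope ereal_scope.
Local Opaque line_integral chord_scale chord_mean.
Context (R : realType) (n : nat).
Local Notation V := 'rV[R]_n.
Local Notation RT := (measurableTypeR R).
Local Notation mu := (borel_lebesgue R n).
Variable nu : {sigma_finite_measure set V -> \bar R}.
Variable k : V -> R.
Implicit Types (f a b : V -> R) (x th : V).

(** Not divided by the total mass of [nu]; that factor enters in [hit_and_run_average]. *)
Definition direction_mean a x : \bar R := \int[nu]_th chord_mean k a x th.

(** Up to the normalizations of [nu] and [k], the inner product of the averaged [a] with [b] in the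
    space weighted by [k]. *)
Definition direction_form a b : \bar R :=
  \int[mu]_x ((b x * k x)%:E * direction_mean a x).

Hypotheses (mk : measurable_fun setT k) (k0 : forall y, (0 <= k y)%R).

Lemma direction_meanE a x :
  direction_mean a x = \int[nu]_th chord_mean k a x th.
Proof. by []. Qed.

Lemma direction_mean_ge0 a x : (forall y, (0 <= a y)%R) -> 0 <= direction_mean a x.
Proof. by move=> a0; apply: integral_ge0 => th _; exact: chord_mean_ge0. Qed.

Lemma measurable_chord_mean1 a x : measurable_fun setT a ->
  measurable_fun setT (chord_mean k a x).
Proof.
by move=> ma; exact: (measurable_fun_pair2 x (measurable_chord_mean mk k0 ma)).
Qed.

Lemma measurable_direction_mean a : measurable_fun setT a ->
  (forall y, (0 <= a y)%R) -> measurable_fun setT (direction_mean a).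
Proof.
move=> ma a0.
apply: (@measurable_fun_fubini_tonelli_F _ _ _ _ _ nu
  (fun p : V * V => chord_mean k a p.1 p.2)).
  exact: measurable_chord_mean.
by move=> p; exact: chord_mean_ge0.
Qed.

(** Tonelli takes the integral over directions outside; in each direction the chord identity
    replaces [b] by its mean, which makes the integrand symmetric. *)
Lemma direction_formE a b :
  measurable_fun setT a -> (forall y, (0 <= a y)%R) ->
  measurable_fun setT b -> (forall y, (0 <= b y)%R) ->
  direction_form a b = \int[nu]_th \int[mu]_x
    ((k x)%:E * (chord_mean k a x th * chord_mean k b x th)).
Proof.
move=> ma a0 mb b0.
have mbk : measurable_fun setT (b \* k)%R by exact: measurable_funM.
transitivity (\int[mu]_x \int[nu]_th ((b x * k x)%:E * chord_mean k a x th)).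
  apply: eq_integral => x _; rewrite ge0_integralZl//.
  - exact: measurable_chord_mean1.
  - by move=> th _; exact: chord_mean_ge0.
  - by rewrite lee_fin mulr_ge0.
rewrite (@fubini_tonelli _ _ _ _ _ mu nu (fun p : V * V =>
    (b p.1 * k p.1)%:E * chord_mean k a p.1 p.2)); first last.
- move=> p; apply: mule_ge0; last exact: chord_mean_ge0.
  by rewrite lee_fin mulr_ge0.
- apply: emeasurable_funM; last exact: measurable_chord_mean.
  by apply/measurable_EFinP; exact: (measurableT_comp mbk measurable_fst).
by apply: eq_integral => th _; exact: integral_chord_meanM.
Qed.

Lemma direction_formC a b :
  measurable_fun setT a -> (forall y, (0 <= a y)%R) ->
  measurable_fun setT b -> (forall y, (0 <= b y)%R) ->
  direction_form a b = direction_form b a.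
Proof.
move=> ma a0 mb b0.
rewrite (direction_formE ma a0 mb b0) (direction_formE mb b0 ma a0).
by apply: eq_integral => th _; apply: eq_integral => x _; rewrite [X in _ * X]muleC.
Qed.

Lemma direction_form_ge0 a b :
  (forall y, (0 <= a y)%R) -> (forall y, (0 <= b y)%R) -> 0 <= direction_form a b.
Proof.
move=> a0 b0; apply: integral_ge0 => x _; apply: mule_ge0.
  by rewrite lee_fin mulr_ge0.
exact: direction_mean_ge0.
Qed.

Let mkMM a b : measurable_fun setT a -> measurable_fun setT b ->
  measurable_fun setT (fun p : V * V =>
    (k p.1)%:E * (chord_mean k a p.1 p.2 * chord_mean k b p.1 p.2)).
Proof.
move=> ma mb; apply: emeasurable_funM.
  by apply/measurable_EFinP; exact: (measurableT_comp mk measurable_fst).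
by apply: emeasurable_funM; exact: measurable_chord_mean.
Qed.

Let kMM0 a b x th : (forall y, (0 <= a y)%R) -> (forall y, (0 <= b y)%R) ->
  0 <= (k x)%:E * (chord_mean k a x th * chord_mean k b x th).
Proof.
move=> a0 b0; apply: mule_ge0; first by rewrite lee_fin.
by apply: mule_ge0; exact: chord_mean_ge0.
Qed.

(** Positivity of the form on the difference of [a] and [b], stated without subtraction: 2 A B <=
    A^2 + B^2 for the two chord means, integrated twice. *)
Lemma direction_form_amgm a b :
  measurable_fun setT a -> (forall y, (0 <= a y)%R) ->
  measurable_fun setT b -> (forall y, (0 <= b y)%R) ->
  direction_form a b + direction_form a b <=
  direction_form a a + direction_form b b.
Proof.
move=> ma a0 mb b0.
pose F a b (th : V) := \int[mu]_x
    ((k x)%:E * (chord_mean k a x th * chord_mean k b x th)).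
have mF (c e : V -> R) : measurable_fun setT c -> (forall y, (0 <= c y)%R) ->
    measurable_fun setT e -> (forall y, (0 <= e y)%R) -> measurable_fun setT (F c e).
  move=> mc c0 me e0; apply: (@measurable_fun_fubini_tonelli_G _ _ _ _ _ mu
    (fun p : V * V => (k p.1)%:E * (chord_mean k c p.1 p.2 * chord_mean k e p.1 p.2))).
    exact: mkMM.
  by move=> p; exact: kMM0.
have F0 (c e : V -> R) th : (forall y, (0 <= c y)%R) -> (forall y, (0 <= e y)%R) -> 0 <= F c e th.
  by move=> c0 e0; apply: integral_ge0 => x _; exact: kMM0.
have mkM (c e : V -> R) th : measurable_fun setT c -> measurable_fun setT e ->
    measurable_fun setT
      (fun x => (k x)%:E * (chord_mean k c x th * chord_mean k e x th)).
  by move=> mc me; exact: (measurable_fun_pair1 th (mkMM mc me)).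
rewrite (direction_formE ma a0 mb b0 : _ = \int[nu]_th F a b th).
rewrite (direction_formE ma a0 ma a0 : _ = \int[nu]_th F a a th).
rewrite (direction_formE mb b0 mb b0 : _ = \int[nu]_th F b b th).
apply: ge0_le_integralDD.
- exact: mF.
- by move=> th; exact: F0.
- exact: mF.
- by move=> th; exact: F0.
- exact: mF.
- by move=> th; exact: F0.
move=> th; apply: ge0_le_integralDD.
- exact: mkM.
- by move=> x; exact: kMM0.
- exact: mkM.
- by move=> x; exact: kMM0.
- exact: mkM.
- by move=> x; exact: kMM0.
move=> x; have ca := chord_mean_ge0 k0 x th a0.
have cb := chord_mean_ge0 k0 x th b0.
move: (chord_mean k a x th) (chord_mean k b x th) ca cb => A B A0 B0.
rewrite -[leLHS]ge0_muleDr ?mule_ge0// -[leRHS]ge0_muleDr ?mule_ge0//.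
by apply: lee_wpmul2l; [rewrite lee_fin|exact: lee_mulDmule].
Qed.

Local Opaque direction_mean.

Lemma direction_mean_cst1 x : direction_mean (cst 1%R) x <= nu setT.
Proof.
rewrite direction_meanE -[leRHS]mul1e -integral_cst//; apply: ge0_le_integral => //.
- by move=> th _; exact: chord_mean_ge0.
- exact: measurable_chord_mean1.
- by move=> th _; exact: chord_mean_cst1.
Qed.

(** Cauchy-Schwarz is used twice: over directions against the constant 1, at the cost of the factor
    [nu setT], and then along each chord. *)
Lemma direction_mean_sqr a x : measurable_fun setT a -> (forall y, (0 <= a y)%R) ->
  direction_mean a x * direction_mean a x <=
  nu setT * direction_mean (fun y => a y ^+ 2)%R x.
Proof.
move=> ma a0.
have ma2 : measurable_fun setT (fun y => a y ^+ 2 : RT)%R.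
  exact: measurable_funX.
have a20 y : (0 <= a y ^+ 2)%R by rewrite sqr_ge0.
rewrite !direction_meanE.
have := @integral_cauchy_schwarz _ _ _ nu (cst 1%R) (chord_mean k a x)
  (@measurable_cst _ _ _ _ _ _) (measurable_chord_mean1 x ma)
  (fun _ => ler01) (fun th => chord_mean_ge0 k0 x th a0).
have -> : \int[nu]_th (cst 1%R th : R)%:E = nu setT.
  by rewrite -[RHS]mul1e -(integral_cst nu measurableT 1).
under eq_integral do rewrite mule1.
under [X in _ <= _ * X -> _]eq_integral do rewrite mule1.
move=> /le_trans; apply; apply: lee_wpmul2l => //.
apply: ge0_le_integral => //.
- by move=> th _; apply: mule_ge0; exact: chord_mean_ge0.
- by apply: emeasurable_funM; exact: measurable_chord_mean1.
- exact: measurable_chord_mean1.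
- by move=> th _; exact: chord_mean_sqr.
Qed.

(** One factor [nu setT] is the price of Cauchy-Schwarz over directions. The other bounds the
    direction mean of 1, which appears when symmetry of the form moves the averaging from [a ^+ 2]
    to the constant. *)
Lemma integral_direction_mean_sqr a :
  measurable_fun setT a -> (forall y, (0 <= a y)%R) ->
  \int[mu]_x ((k x)%:E * (direction_mean a x * direction_mean a x)) <=
  nu setT * nu setT * \int[mu]_x (a x ^+ 2 * k x)%:E.
Proof.
move=> ma a0.
have ma2 : measurable_fun setT (fun y => a y ^+ 2 : RT)%R.
  exact: measurable_funX.
have a20 y : (0 <= a y ^+ 2)%R by rewrite sqr_ge0.
have mk' : measurable_fun setT (fun x => (k x)%:E) by exact/measurable_EFinP.
have ma2k : measurable_fun setT (fun x => (a x ^+ 2 * k x)%:E).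
  by apply/measurable_EFinP; exact: measurable_funM.
have mda := measurable_direction_mean ma a0.
have mda2 := measurable_direction_mean ma2 a20.
have kdd0 x : 0 <= (k x)%:E * (direction_mean a x * direction_mean a x).
  apply: mule_ge0; first by rewrite lee_fin.
  by apply: mule_ge0; exact: direction_mean_ge0.
have mkdd : measurable_fun setT
    (fun x => (k x)%:E * (direction_mean a x * direction_mean a x)).
  apply: emeasurable_funM; first exact: mk'.
  exact: (emeasurable_funM mda mda).
have m1k : measurable_fun setT (fun x => (cst 1%R x * k x)%:E).
  rewrite (_ : (fun _ => _) = fun x => (k x)%:E)//.
  by apply/funext => x; rewrite /cst mul1r.
have m1kd := emeasurable_funM m1k mda2.
apply: (@le_trans _ _ (\int[mu]_x
    (nu setT * ((cst 1%R x * k x)%:E * direction_mean (fun y => a y ^+ 2)%R x)))).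
  apply: ge0_le_integral; first exact: measurableT.
  - by move=> x _; exact: kdd0.
  - exact: mkdd.
  - apply: emeasurable_funM; first exact: measurable_cst.
    exact: m1kd.
  - move=> x _; rewrite /cst mul1r [leRHS]muleCA; apply: lee_wpmul2l.
      by rewrite lee_fin.
    exact: direction_mean_sqr.
rewrite ge0_integralZl//; last first.
  move=> x _; apply: mule_ge0; last exact: direction_mean_ge0.
  by rewrite lee_fin mulr_ge0.
have m1 : measurable_fun [set: V] (cst 1%R : V -> RT) by exact: measurable_cst.
rewrite -[X in _ * X]/(direction_form (fun y => a y ^+ 2)%R (cst 1%R)).
rewrite (direction_formC ma2 a20 m1 (fun _ => ler01)).
rewrite -muleA; apply: lee_wpmul2l; first exact: measure_ge0.
rewrite -ge0_integralZl//; last first.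
  by move=> x _; rewrite lee_fin mulr_ge0.
apply: ge0_le_integral; first exact: measurableT.
- move=> x _; apply: mule_ge0; last exact: direction_mean_ge0.
  by rewrite lee_fin mulr_ge0.
- apply: (emeasurable_funM ma2k).
  exact: (measurable_direction_mean m1 (fun _ => ler01)).
- apply: emeasurable_funM; last exact: ma2k.
  exact: measurable_cst.
- move=> x _; rewrite [leRHS]muleC; apply: lee_wpmul2l.
    by rewrite lee_fin mulr_ge0.
  exact: direction_mean_cst1.
Qed.

Hypothesis nuoo : nu setT < +oo.

Lemma integral_direction_mean_sqr_lty a :
  measurable_fun setT a -> (forall y, (0 <= a y)%R) ->
  \int[mu]_x (a x ^+ 2 * k x)%:E < +oo ->
  \int[mu]_x ((k x)%:E * (direction_mean a x * direction_mean a x)) < +oo.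
Proof.
move=> ma a0 aoo; apply: le_lt_trans (integral_direction_mean_sqr ma a0) _.
rewrite lte_mul_pinfty// ?mule_ge0// ge0_fin_numE ?mule_ge0//.
by rewrite lte_mul_pinfty// ge0_fin_numE.
Qed.

(** The integrand is at most [k] times the sum of the squares of [b] and of the direction mean of
    [a], and both terms have finite integral. *)
Lemma direction_form_lty a b :
  measurable_fun setT a -> (forall y, (0 <= a y)%R) ->
  measurable_fun setT b -> (forall y, (0 <= b y)%R) ->
  \int[mu]_x (a x ^+ 2 * k x)%:E < +oo -> \int[mu]_x (b x ^+ 2 * k x)%:E < +oo ->
  direction_form a b < +oo.
Proof.
move=> ma a0 mb b0 aoo boo.
have mda := measurable_direction_mean ma a0.
have mk' : measurable_fun setT (fun x => (k x)%:E) by exact/measurable_EFinP.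
have mb2k : measurable_fun setT (fun x => (b x ^+ 2 * k x)%:E).
  by apply/measurable_EFinP; apply: measurable_funM => //; exact: measurable_funX.
have Hoo := integral_direction_mean_sqr_lty ma a0 aoo.
have mH : measurable_fun setT
    (fun x => (k x)%:E * (direction_mean a x * direction_mean a x)).
  by apply: emeasurable_funM => //; exact: emeasurable_funM.
have H0 x : 0 <= (k x)%:E * (direction_mean a x * direction_mean a x).
  apply: mule_ge0; first by rewrite lee_fin.
  by apply: mule_ge0; exact: direction_mean_ge0.
have b20 x : 0 <= (b x ^+ 2 * k x)%:E by rewrite lee_fin mulr_ge0// sqr_ge0.
apply: (@le_lt_trans _ _ (\int[mu]_x ((b x ^+ 2 * k x)%:E +
    (k x)%:E * (direction_mean a x * direction_mean a x)))); last first.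
  by rewrite ge0_integralD// lte_add_pinfty.
apply: ge0_le_integral => //.
- move=> x _; apply: mule_ge0; last exact: direction_mean_ge0.
  by rewrite lee_fin mulr_ge0.
- apply: emeasurable_funM => //.
  by apply/measurable_EFinP; exact: measurable_funM.
- exact: emeasurable_funD.
- move=> x _; have d0 := direction_mean_ge0 x a0.
  have b0' : 0 <= (b x)%:E by rewrite lee_fin.
  rewrite (_ : (b x ^+ 2 * k x)%:E = (k x)%:E * ((b x)%:E * (b x)%:E)); last first.
    by rewrite -!EFinM mulrC expr2.
  rewrite -ge0_muleDr ?mule_ge0// mulrC EFinM -muleA.
  apply: lee_wpmul2l; first by rewrite lee_fin.
  apply: le_trans (lee_mulDmule b0' d0).
  by rewrite leeDl// mule_ge0.
Qed.

End direction_mean.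

Lemma fine_abse_le (R : realDomainType) (x : \bar R) : (`|fine x|%:E <= `|x|)%E.
Proof. by case: x => [r| |] /=; rewrite ?normr0 ?leey. Qed.

Lemma integrableZl_EFin d (T : measurableType d) (R : realType)
    (m : {measure set T -> \bar R}) (a : R) (f : T -> R) :
  m.-integrable setT (EFin \o f) -> m.-integrable setT (EFin \o (fun x => a * f x)).
Proof. by move=> /(integrableZl measurableT a). Qed.

(** * The real-valued average of signed Borel functions *)

Section chord_average.
Local Open Scope ereal_scope.
Local Opaque line_integral chord_scale chord_mean direction_mean.
Context (R : realType) (n : nat).
Local Notation V := 'rV[R]_n.
Local Notation RT := (measurableTypeR R).
Local Notation lam := (@lebesgue_measure R).
Local Notation mu := (borel_lebesgue R n).
Variable nu : {finite_measure set V -> \bar R}.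
Variable k : V -> R.
Implicit Types (f g u : V -> R) (x th : V).

(** The real counterpart of [chord_mean], with [fine] placed as in the real integrals of
    [hit_and_run], so that an integral with infinite value counts as 0. *)
Definition chord_average g x th : R :=
  (chord_scale k x th * fine (line_integral (g \* k)%R x th))%R.

Definition hit_and_run_average g x : R :=
  ((fine (nu setT))^-1 * fine (\int[nu]_th (chord_average g x th)%:E))%R.

Hypotheses (mk : measurable_fun setT k) (k0 : forall y, (0 <= k y)%R).

Let c0 x th : 0 <= (chord_scale k x th)%:E.
Proof. by rewrite lee_fin chord_scale_ge0. Qed.

Let nuoo : nu setT < +oo.
Proof. by rewrite -ge0_fin_numE// fin_num_measure. Qed.

Let mM g : measurable_fun setT g -> measurable_fun setT (g \* k)%R.
Proof. by move=> mg; exact: measurable_funM. Qed.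

Let mabs g : measurable_fun setT g -> measurable_fun setT (fun y => `|g y|%R : RT).
Proof. by move=> mg; exact: measurableT_comp. Qed.

Lemma measurable_chord_average g : measurable_fun setT g ->
  measurable_fun setT (fun p : V * V => chord_average g p.1 p.2 : RT).
Proof.
move=> mg; apply: measurable_funM; first exact: measurable_chord_scale.
apply: measurableT_comp => //.
exact: measurable_line_integral (mM mg).
Qed.

Lemma measurable_chord_average1 g x : measurable_fun setT g ->
  measurable_fun setT (fun th => (chord_average g x th)%:E).
Proof.
move=> mg; apply/measurable_EFinP.
exact: (measurable_fun_pair2 x (measurable_chord_average mg)).
Qed.

Lemma measurable_hit_and_run_average g : measurable_fun setT g ->
  measurable_fun setT (hit_and_run_average g : V -> RT).
Proof.
move=> mg; apply: measurable_funM => //; apply: measurableT_comp => //.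
pose F (p : V * V) := (chord_average g p.1 p.2)%:E.
have mF : measurable_fun setT F.
  by apply/measurable_EFinP; exact: measurable_chord_average.
rewrite (_ : (fun _ => _) =
    (fun x => (fubini_F nu F^\+ x) - (fubini_F nu F^\- x))).
  apply: emeasurable_funB; apply: measurable_fun_fubini_tonelli_F => //.
    exact: measurable_funepos.
  exact: measurable_funeneg.
apply/funext => x; rewrite integralE /fubini_F.
by congr (_ - _); apply: eq_integral => th _; rewrite ?funeposE ?funenegE.
Qed.

(** [fine] can only lower an absolute value, so divergent integrals are covered by the same
    bound. *)
Lemma chord_average_le g x th : measurable_fun setT g ->
  (`|chord_average g x th|)%:E <= chord_mean k (fun y => `|g y|)%R x th.
Proof.
move=> mg; rewrite chord_meanE normrM EFinM ger0_norm ?chord_scale_ge0//.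
apply: lee_wpmul2l => //; apply: (le_trans (fine_abse_le _)).
rewrite !line_integralE; apply: le_trans (le_abse_integral _ _ _) _ => //.
  by apply/measurable_EFinP; exact: measurable_line_fun (mM mg).
apply: ge0_le_integral => //.
- apply: measurableT_comp => //; apply/measurable_EFinP.
  exact: measurable_line_fun (mM mg).
- by apply/measurable_EFinP; exact: measurable_line_fun (mM (mabs mg)).
- by move=> s _; rewrite lee_fin normrM (ger0_norm (k0 _)).
Qed.

Lemma integrable_chord_average g x : measurable_fun setT g ->
  direction_mean nu k (fun y => `|g y|)%R x < +oo ->
  nu.-integrable setT (fun th => (chord_average g x th)%:E).
Proof.
move=> mg goo; apply/integrableP; split; first exact: measurable_chord_average1.
apply: le_lt_trans goo; rewrite direction_meanE; apply: ge0_le_integral => //.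
- by apply: measurableT_comp => //; exact: measurable_chord_average1.
- exact: (measurable_chord_mean1 mk k0 x (mabs mg)).
- by move=> th _; exact: chord_average_le.
Qed.

(** A finite direction mean makes the chord mean of |g| finite in almost every direction. With a
    nonzero scale this bounds the integral along the chord; with scale 0 the mean carries no
    information, hence the premise. *)
Lemma ae_integrable_chord g x : measurable_fun setT g ->
  direction_mean nu k (fun y => `|g y|)%R x < +oo ->
  {ae nu, forall th, chord_scale k x th != 0%R ->
    lam.-integrable setT (fun s : RT => ((g \* k)%R (x + (s : R) *: th)%R)%:E)}.
Proof.
move=> mg goo.
have mm := measurable_chord_mean1 mk k0 x (mabs mg).
have m0 th : 0 <= chord_mean k (fun y => `|g y|)%R x th.
  by apply: chord_mean_ge0 => // y.
have /integrable_ae : nu.-integrable setT (chord_mean k (fun y => `|g y|)%R x).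
  apply/integrableP; split => //.
  by under eq_integral => th _ do rewrite gee0_abs//.
move=> /(_ measurableT); apply: filterS => th /(_ I).
rewrite chord_meanE => fin cn0; apply/integrableP; split.
  by apply/measurable_EFinP; exact: measurable_line_fun (mM mg).
rewrite (_ : \int[_]_s _ = line_integral ((fun y => `|g y|) \* k)%R x th); last first.
  rewrite line_integralE; apply: eq_integral => s _ /=.
  by rewrite normrM (ger0_norm (k0 _)).
have L0 : 0 <= line_integral ((fun y => `|g y|) \* k)%R x th.
  by apply: line_integral_ge0 => y /=; rewrite mulr_ge0.
rewrite ltey; apply/negP => /eqP Loo; move: fin; rewrite Loo.
by rewrite gt0_muley// lte_fin lt_neqAle eq_sym cn0 chord_scale_ge0.
Qed.

(** On degenerate chords all the averages are 0; on almost all other chords both functions are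
    integrable against the weight. *)
Lemma chord_average_linear (a : R) f g x : measurable_fun setT f ->
  measurable_fun setT g ->
  direction_mean nu k (fun y => `|f y|)%R x < +oo ->
  direction_mean nu k (fun y => `|g y|)%R x < +oo ->
  {ae nu, forall th, chord_average (fun y => a * f y + g y)%R x th =
    (a * chord_average f x th + chord_average g x th)%R}.
Proof.
move=> mf mg foo goo.
have := ae_integrable_chord mf foo.
have := ae_integrable_chord mg goo.
apply: filterS2 => th gi fi.
rewrite /chord_average; have [->|cn0] := eqVneq (chord_scale k x th) 0%R.
  by rewrite !mul0r mulr0 addr0.
rewrite [RHS](_ : _ = chord_scale k x th *
    (a * fine (line_integral (f \* k)%R x th) +
     fine (line_integral (g \* k)%R x th)))%R; last by ring.
congr (_ * _)%R; rewrite !line_integralE.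
transitivity (Rintegral lam setT (fun s : RT =>
    a * (f \* k) (x + (s : R) *: th) + (g \* k) (x + (s : R) *: th))%R).
  by congr fine; apply: eq_integral => s _ /=; rewrite mulrDl mulrA.
rewrite RintegralD//; first by rewrite RintegralZl//; exact: fi.
- by apply: integrableZl_EFin; exact: fi.
- exact: gi.
Qed.

Lemma hit_and_run_average_linear (a : R) f g x : measurable_fun setT f ->
  measurable_fun setT g ->
  direction_mean nu k (fun y => `|f y|)%R x < +oo ->
  direction_mean nu k (fun y => `|g y|)%R x < +oo ->
  hit_and_run_average (fun y => a * f y + g y)%R x =
  (a * hit_and_run_average f x + hit_and_run_average g x)%R.
Proof.
move=> mf mg foo goo; rewrite /hit_and_run_average.
have fi := integrable_chord_average mf foo.
have gi := integrable_chord_average mg goo.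
rewrite [X in _ = (X + _)%R]mulrCA -mulrDr; congr (_ * _)%R.
transitivity (Rintegral nu setT
    (fun th => a * chord_average f x th + chord_average g x th)%R).
  congr fine; apply: ae_eq_integral => //.
  - apply: measurable_chord_average1; apply: measurable_funD => //.
    exact: measurable_funM.
  - apply/measurable_EFinP; apply: measurable_funD.
      apply: measurable_funM => //.
      by apply/measurable_EFinP; exact: measurable_chord_average1.
    by apply/measurable_EFinP; exact: measurable_chord_average1.
  - have := chord_average_linear a mf mg foo goo.
    by apply: filterS => th -> _.
rewrite RintegralD//; first by rewrite RintegralZl.
exact: integrableZl_EFin.
Qed.

(** In almost every direction the chord mean of [u] is finite, so the inner [fine] loses nothing
    there. *)
Lemma hit_and_run_average_ge0E u x : measurable_fun setT u ->
  (forall y, (0 <= u y)%R) -> direction_mean nu k u x < +oo ->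
  hit_and_run_average u x = ((fine (nu setT))^-1 * fine (direction_mean nu k u x))%R.
Proof.
move=> mu' u0 uoo; rewrite /hit_and_run_average; congr (_ * fine _)%R.
rewrite direction_meanE.
have mm := measurable_chord_mean1 mk k0 x mu'.
apply: ae_eq_integral => //; first exact: measurable_chord_average1.
have /integrable_ae : nu.-integrable setT (chord_mean k u x).
  apply/integrableP; split => //.
  under eq_integral => th _ do rewrite gee0_abs ?chord_mean_ge0//.
  by rewrite -direction_meanE.
move=> /(_ measurableT); apply: filterS => th /(_ I) + _.
rewrite chord_meanE /chord_average => fin.
have [c_0|cn0] := eqVneq (chord_scale k x th) 0%R.
  by rewrite c_0 mul0r mul0e.
rewrite EFinM fineK// ge0_fin_numE; last first.
  by apply: line_integral_ge0 => y /=; rewrite mulr_ge0.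
rewrite ltey; apply/negP => /eqP Loo; move: fin; rewrite Loo.
by rewrite gt0_muley// lte_fin lt_neqAle eq_sym cn0 chord_scale_ge0.
Qed.

Lemma hit_and_run_average_le g x : measurable_fun setT g ->
  `|hit_and_run_average g x|%:E <=
  ((fine (nu setT))^-1)%:E * direction_mean nu k (fun y => `|g y|)%R x.
Proof.
move=> mg; rewrite /hit_and_run_average normrM EFinM ger0_norm; last first.
  by rewrite invr_ge0 fine_ge0.
apply: lee_wpmul2l; first by rewrite lee_fin invr_ge0 fine_ge0.
apply: (le_trans (fine_abse_le _)).
apply: le_trans (le_abse_integral _ _ _) _ => //.
  exact: measurable_chord_average1.
rewrite direction_meanE; apply: ge0_le_integral => //.
- by apply: measurableT_comp => //; exact: measurable_chord_average1.
- exact: (measurable_chord_mean1 mk k0 x (mabs mg)).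
- by move=> th _; exact: chord_average_le.
Qed.

(** [k] times the squared mean has finite integral and is therefore finite almost everywhere; a
    nonzero [k] passes this on to the mean itself. *)
Lemma ae_direction_mean_lty g : measurable_fun setT g ->
  \int[mu]_x (g x ^+ 2 * k x)%:E < +oo ->
  {ae mu, forall x, k x != 0%R -> direction_mean nu k (fun y => `|g y|)%R x < +oo}.
Proof.
move=> mg goo.
have ng0 y : (0 <= `|g y|)%R by [].
have d0 x := direction_mean_ge0 nu k0 x ng0.
have md := measurable_direction_mean nu mk k0 (mabs mg) ng0.
have := integral_direction_mean_sqr_lty mk k0 nuoo (mabs mg) ng0.
under eq_integral do rewrite real_normK ?num_real//.
move=> /(_ goo) oo.
have /integrable_ae : mu.-integrable setT (fun x => (k x)%:E *
    (direction_mean nu k (fun y => `|g y|)%R x *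
     direction_mean nu k (fun y => `|g y|)%R x)).
  apply/integrableP; split.
    apply: emeasurable_funM; first exact/measurable_EFinP.
    exact: (emeasurable_funM md md).
  under eq_integral => x _.
    rewrite gee0_abs; last by apply: mule_ge0; rewrite ?lee_fin// mule_ge0.
    over.
  exact: oo.
move=> /(_ measurableT); apply: filterS => x /(_ I) + kn0.
rewrite ltey; move=> fin; apply/negP => /eqP doo; move: fin; rewrite doo mulyy.
by rewrite gt0_muley// lte_fin lt_neqAle eq_sym kn0 k0.
Qed.

(** Pointwise the average is at most [q] times the direction mean of |g|, and the square of [q]
    cancels the two factors [nu setT] of the square bound. *)
Lemma hit_and_run_average_contraction g : measurable_fun setT g ->
  \int[mu]_x (hit_and_run_average g x ^+ 2 * k x)%:E <=
  \int[mu]_x (g x ^+ 2 * k x)%:E.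
Proof.
move=> mg.
have ng0 y : (0 <= `|g y|)%R by [].
have d0 x := direction_mean_ge0 nu k0 x ng0.
have md := measurable_direction_mean nu mk k0 (mabs mg) ng0.
set d := direction_mean nu k (fun y => `|g y|)%R in d0 md *.
have mk' : measurable_fun setT (fun x => (k x)%:E) by exact/measurable_EFinP.
have kap0 : (0 <= (fine (nu setT))^-1)%R by rewrite invr_ge0 fine_ge0.
have kd0 x : 0 <= (k x)%:E * (d x * d x).
  by apply: mule_ge0; rewrite ?lee_fin// mule_ge0.
have mkd := emeasurable_funM mk' (emeasurable_funM md md).
set q := (fine (nu setT))^-1%R.
apply: (@le_trans _ _ (\int[mu]_x ((q * q)%:E * ((k x)%:E * (d x * d x))))).
  apply: ge0_le_integral => //.
  - by move=> x _; rewrite lee_fin mulr_ge0// sqr_ge0.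
  - apply/measurable_EFinP; apply: measurable_funM => //.
    by apply: measurable_funX; exact: measurable_hit_and_run_average.
  - exact: (emeasurable_funM (@measurable_cst _ _ _ _ _ _) mkd).
  - move=> x _; have := hit_and_run_average_le x mg; rewrite -/q -/d => le.
    rewrite (_ : (_ * _)%:E = (k x)%:E *
      (`|hit_and_run_average g x|%:E * `|hit_and_run_average g x|%:E)); last first.
      by rewrite -!EFinM -expr2 real_normK ?num_real// mulrC.
    rewrite [leRHS]muleCA.
    apply: lee_wpmul2l; first by rewrite lee_fin.
    by rewrite EFinM muleACA; apply: lee_pmul; rewrite ?lee_fin.
rewrite ge0_integralZl//; last by rewrite lee_fin mulr_ge0.
apply: (@le_trans _ _ ((q * q)%:E *
    (nu setT * nu setT * \int[mu]_x (`|g x|%R ^+ 2 * k x)%:E))).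
  apply: lee_wpmul2l; first by rewrite lee_fin mulr_ge0.
  exact: (integral_direction_mean_sqr nu mk k0 (mabs mg) ng0).
under eq_integral do rewrite real_normK ?num_real//.
rewrite muleA -[leRHS]mul1e; apply: lee_wpmul2r.
  by apply: integral_ge0 => x _; rewrite lee_fin mulr_ge0// sqr_ge0.
rewrite -[nu setT]fineK ?fin_num_measure// -!EFinM lee_fin /q.
(* If [nu] has no mass, the product to be bounded by 1 is 0; otherwise it is 1. *)
have [->|N0] := eqVneq (fine (nu setT)) 0%R; first by rewrite mulr0 mulr0.
by rewrite mulrACA mulVf// mulr1.
Qed.

End chord_average.

(** * Symmetry and positivity for signed Borel functions *)

Section hit_and_run_form.
Local Open Scope ereal_scope.
Local Opaque line_integral chord_scale chord_mean direction_mean.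
Context (R : realType) (n : nat).
Local Notation V := 'rV[R]_n.
Local Notation RT := (measurableTypeR R).
Local Notation mu := (borel_lebesgue R n).
Variable nu : {finite_measure set V -> \bar R}.
Variable k : V -> R.
Implicit Types (f g u v : V -> R) (x th : V).
Hypotheses (mk : measurable_fun setT k) (k0 : forall y, (0 <= k y)%R).

Local Notation T := (hit_and_run_average nu k).
Local Notation sqr_integral g := (\int[mu]_x (g x ^+ 2 * k x)%:E).
Local Notation q := ((fine (nu setT))^-1)%R.

Let nuoo : nu setT < +oo.
Proof. by rewrite -ge0_fin_numE// fin_num_measure. Qed.

Let q0 : (0 <= q)%R.
Proof. by rewrite invr_ge0 fine_ge0. Qed.

Lemma hit_and_run_average_ge0 u x : (forall y, (0 <= u y)%R) -> (0 <= T u x)%R.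
Proof.
move=> u0; rewrite mulr_ge0// fine_ge0//; apply: integral_ge0 => th _.
rewrite lee_fin mulr_ge0 ?chord_scale_ge0// fine_ge0//.
by apply: line_integral_ge0 => y; rewrite mulr_ge0.
Qed.

Local Opaque hit_and_run_average.

Section nonnegative.
Variables (u v : V -> R).
Hypotheses (mu' : measurable_fun setT u) (u0 : forall y, (0 <= u y)%R).
Hypotheses (mv : measurable_fun setT v) (v0 : forall y, (0 <= v y)%R).
Hypotheses (uoo : sqr_integral u < +oo) (voo : sqr_integral v < +oo).

Let mTuvk : measurable_fun setT (fun x => (T u x * v x * k x)%:E).
Proof.
apply/measurable_EFinP; apply: measurable_funM => //; apply: measurable_funM => //.
exact: measurable_hit_and_run_average.
Qed.

Let Tuvk0 x : 0 <= (T u x * v x * k x)%:E.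
Proof.
rewrite lee_fin; apply: mulr_ge0 => //; apply: mulr_ge0 => //.
exact: hit_and_run_average_ge0.
Qed.

(** The integrands agree almost everywhere: where [k] is 0 both vanish, and elsewhere the direction
    mean is finite, so that [T u] is [q] times it. *)
Lemma integral_hit_and_run_average_ge0 :
  \int[mu]_x (T u x * v x * k x)%:E = q%:E * direction_form nu k u v.
Proof.
have mvk : measurable_fun setT (fun x => (v x * k x)%:E).
  by apply/measurable_EFinP; exact: measurable_funM.
have md := measurable_direction_mean nu mk k0 mu' u0.
have vkd0 x : 0 <= (v x * k x)%:E * direction_mean nu k u x.
  by apply: mule_ge0; [rewrite lee_fin mulr_ge0|exact: direction_mean_ge0].
rewrite -ge0_integralZl//; last exact: emeasurable_funM.
apply: ge0_ae_eq_integral => //.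
- by apply: emeasurable_funM => //; exact: emeasurable_funM.
- by move=> x _; apply: mule_ge0; rewrite // lee_fin.
have uE : (fun y => `|u y|)%R = u by apply/funext => y; rewrite ger0_norm.
have := ae_direction_mean_lty nu mk k0 mu' uoo; rewrite uE.
apply: filterS => x xoo _.
have [->|kn0] := eqVneq (k x) 0%R; first by rewrite !mulr0 mul0e mule0.
rewrite hit_and_run_average_ge0E//; last exact: xoo.
rewrite -mulrA EFinM EFinM -muleA; congr (_ * _).
rewrite muleC fineK// ge0_fin_numE; last exact: direction_mean_ge0.
exact: xoo.
Qed.

Lemma integrable_hit_and_run_average_ge0 :
  mu.-integrable setT (fun x => (T u x * v x * k x)%:E).
Proof.
apply/integrableP; split => //.
under eq_integral => x _.
  rewrite gee0_abs; last exact: Tuvk0.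
  over.
rewrite integral_hit_and_run_average_ge0 lte_mul_pinfty ?lee_fin//.
exact: direction_form_lty.
Qed.

Lemma Rintegral_hit_and_run_average_ge0 :
  (\int[mu]_x (T u x * v x * k x) = q * fine (direction_form nu k u v))%R.
Proof.
rewrite /Rintegral integral_hit_and_run_average_ge0 fineM//.
rewrite ge0_fin_numE; first exact: direction_form_lty.
exact: direction_form_ge0.
Qed.

End nonnegative.

Let mpos g : measurable_fun setT g -> measurable_fun setT (g^\+)%R.
Proof. exact: measurable_funrpos. Qed.

Let mneg g : measurable_fun setT g -> measurable_fun setT (g^\-)%R.
Proof. exact: measurable_funrneg. Qed.

Lemma sqr_integral_le f g : measurable_fun setT f -> measurable_fun setT g ->
  (forall x, `|f x| <= `|g x|)%R -> sqr_integral g < +oo -> sqr_integral f < +oo.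
Proof.
move=> mf mg fg; apply: le_lt_trans; apply: ge0_le_integral => //.
- by move=> x _; rewrite lee_fin mulr_ge0// sqr_ge0.
- by apply/measurable_EFinP; apply: measurable_funM => //; exact: measurable_funX.
- by apply/measurable_EFinP; apply: measurable_funM => //; exact: measurable_funX.
- move=> x _; rewrite lee_fin ler_wpM2r// -[leLHS]real_normK ?num_real//.
  by rewrite -[leRHS]real_normK ?num_real// lerXn2r// nnegrE.
Qed.

Lemma funrpos_norm_le g x : (`|(g^\+)%R x| <= `|g x|)%R.
Proof.
rewrite ger0_norm ?funrpos_ge0// -[leRHS]/((Num.norm \o g) x) -funrposDneg.
by rewrite lerDl funrneg_ge0.
Qed.

Lemma funrneg_norm_le g x : (`|(g^\-)%R x| <= `|g x|)%R.
Proof.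
rewrite ger0_norm ?funrneg_ge0// -[leRHS]/((Num.norm \o g) x) -funrposDneg.
by rewrite lerDr funrpos_ge0.
Qed.

Let pos_lty g : measurable_fun setT g -> sqr_integral g < +oo ->
  sqr_integral (g^\+)%R < +oo.
Proof.
by move=> mg; apply: sqr_integral_le => // [|x];
  [exact: mpos|exact: funrpos_norm_le].
Qed.

Let neg_lty g : measurable_fun setT g -> sqr_integral g < +oo ->
  sqr_integral (g^\-)%R < +oo.
Proof.
by move=> mg; apply: sqr_integral_le => // [|x];
  [exact: mneg|exact: funrneg_norm_le].
Qed.

(** Restricted to nonzero [k] because only there are the direction means known to be finite almost
    everywhere. *)
Lemma ae_hit_and_run_average_linear (a : R) f g :
  measurable_fun setT f -> measurable_fun setT g ->
  sqr_integral f < +oo -> sqr_integral g < +oo ->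
  {ae mu, forall x, k x != 0%R ->
    T (fun y => a * f y + g y)%R x = (a * T f x + T g x)%R}.
Proof.
move=> mf mg foo goo.
have := ae_direction_mean_lty nu mk k0 mf foo.
have := ae_direction_mean_lty nu mk k0 mg goo.
apply: filterS2 => x gx fx kn0.
by apply: hit_and_run_average_linear => //; [exact: fx|exact: gx].
Qed.

Lemma ae_hit_and_run_average_posneg g : measurable_fun setT g ->
  sqr_integral g < +oo ->
  {ae mu, forall x, k x != 0%R -> T g x = (T (g^\+) x - T (g^\-) x)%R}.
Proof.
move=> mg goo.
have := ae_hit_and_run_average_linear (-1) (mneg mg) (mpos mg)
  (neg_lty mg goo) (pos_lty mg goo).
apply: filterS => x + kn0 => /(_ kn0).
rewrite (_ : (fun y => -1 * (g^\-)%R y + (g^\+)%R y)%R = g).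
  by move=> ->; rewrite mulN1r addrC.
apply/funext => y; rewrite mulN1r addrC.
by rewrite -[RHS]/(g y) -[in RHS](funrposBneg g).
Qed.

Local Notation P u v := (q * fine (direction_form nu k u v))%R.

(** Bilinear expansion along the positive and negative parts of both functions; each of the four
    products is integrable, which permits splitting the integral. *)
Lemma Rintegral_hit_and_run_average f g :
  measurable_fun setT f -> measurable_fun setT g ->
  sqr_integral f < +oo -> sqr_integral g < +oo ->
  (\int[mu]_x (T g x * f x * k x) =
   (P (g^\+) (f^\+) - P (g^\-) (f^\+)) - (P (g^\+) (f^\-) - P (g^\-) (f^\-)))%R.
Proof.
move=> mf mg foo goo.
have mp := mpos mf; have mm := mneg mf.
have mp' := mpos mg; have mm' := mneg mg.
have po := pos_lty mf foo; have no := neg_lty mf foo.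
have po' := pos_lty mg goo; have no' := neg_lty mg goo.
have fp0 := funrpos_ge0 f; have fm0 := funrneg_ge0 f.
have gp0 := funrpos_ge0 g; have gm0 := funrneg_ge0 g.
have Ipp := integrable_hit_and_run_average_ge0 mp' gp0 mp fp0 po' po.
have Imp := integrable_hit_and_run_average_ge0 mm' gm0 mp fp0 no' po.
have Ipm := integrable_hit_and_run_average_ge0 mp' gp0 mm fm0 po' no.
have Imm := integrable_hit_and_run_average_ge0 mm' gm0 mm fm0 no' no.
transitivity (
  (\int[mu]_x (T (g^\+) x * f^\+ x * k x) - \int[mu]_x (T (g^\-) x * f^\+ x * k x)) -
  (\int[mu]_x (T (g^\+) x * f^\- x * k x) - \int[mu]_x (T (g^\-) x * f^\- x * k x)))%R;
    last first.
  congr (_ - _ - (_ - _))%R.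
  - exact: (Rintegral_hit_and_run_average_ge0 mp' gp0 mp fp0 po' po).
  - exact: (Rintegral_hit_and_run_average_ge0 mm' gm0 mp fp0 no' po).
  - exact: (Rintegral_hit_and_run_average_ge0 mp' gp0 mm fm0 po' no).
  - exact: (Rintegral_hit_and_run_average_ge0 mm' gm0 mm fm0 no' no).
transitivity (\int[mu]_x
    ((T (g^\+) x * f^\+ x * k x - T (g^\-) x * f^\+ x * k x) -
     (T (g^\+) x * f^\- x * k x - T (g^\-) x * f^\- x * k x)))%R; last first.
  rewrite (RintegralB measurableT (integrableB measurableT Ipp Imp)
    (integrableB measurableT Ipm Imm)).
  by congr (_ - _)%R; [exact: (RintegralB measurableT Ipp Imp)|
    exact: (RintegralB measurableT Ipm Imm)].
congr fine; apply: ae_eq_integral => //.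
- apply/measurable_EFinP; apply: measurable_funM => //; apply: measurable_funM => //.
  exact: measurable_hit_and_run_average.
- have [mpp mmp mpm mmm] : [/\ measurable_fun setT (fun x => T (g^\+)%R x * f^\+ x * k x : RT)%R,
      measurable_fun setT (fun x => T (g^\-)%R x * f^\+ x * k x : RT)%R,
      measurable_fun setT (fun x => T (g^\+)%R x * f^\- x * k x : RT)%R &
      measurable_fun setT (fun x => T (g^\-)%R x * f^\- x * k x : RT)%R].
    by split; apply: measurable_funM => //; apply: measurable_funM => //;
      exact: measurable_hit_and_run_average.
  apply/measurable_EFinP.
  exact: (measurable_funB (measurable_funB mpp mmp) (measurable_funB mpm mmm)).
have := ae_hit_and_run_average_posneg mg goo.
apply: filterS => x + _; move=> tE; apply: (congr1 EFin); move: tE => /=.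
have fE : f x = (f^\+ x - f^\- x)%R by rewrite -[in LHS](funrposBneg f).
rewrite fE; move: (T _ x) (T _ x) (T _ x) ((f^\+)%R x) ((f^\-)%R x) (k x).
move=> t a b c e r tE; have [->|r0] := eqVneq r 0%R; first by ring.
by rewrite (tE r0); ring.
Qed.

(** Symmetry of the form on nonnegative functions transposes the two-by-two array of forms,
    exchanging the two mixed terms. *)
Lemma direction_form_sub_sym u u' v v' :
  measurable_fun setT u -> (forall y, (0 <= u y)%R) ->
  measurable_fun setT u' -> (forall y, (0 <= u' y)%R) ->
  measurable_fun setT v -> (forall y, (0 <= v y)%R) ->
  measurable_fun setT v' -> (forall y, (0 <= v' y)%R) ->
  ((P u v - P u' v) - (P u v' - P u' v') =
   (P v u - P v' u) - (P v u' - P v' u'))%R.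
Proof.
move=> mu_ u0 mu' u'0 mv v0 mv' v'0.
have swap (r a b c e a' b' c' e' : R) : a = a' -> b = b' -> c = c' -> e = e' ->
    ((r * a - r * b) - (r * c - r * e) = (r * a' - r * c') - (r * b' - r * e'))%R.
  by move=> -> -> -> ->; ring.
exact: (swap _ _ _ _ _ _ _ _ _
  (congr1 fine (direction_formC nu mk k0 mu_ u0 mv v0))
  (congr1 fine (direction_formC nu mk k0 mu' u'0 mv v0))
  (congr1 fine (direction_formC nu mk k0 mu_ u0 mv' v'0))
  (congr1 fine (direction_formC nu mk k0 mu' u'0 mv' v'0))).
Qed.

(** Positivity on u - v, to be used with the positive and negative parts. As all the forms are
    finite and the mixed ones coincide, [direction_form_amgm] can be rearranged into a
    difference. *)
Lemma direction_form_sub_ge0 u v :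
  measurable_fun setT u -> (forall y, (0 <= u y)%R) ->
  measurable_fun setT v -> (forall y, (0 <= v y)%R) ->
  sqr_integral u < +oo -> sqr_integral v < +oo ->
  (0 <= (P u u - P v u) - (P u v - P v v))%R.
Proof.
move=> mu_ u0 mv v0 uoo voo.
have fin (a b : V -> R) : measurable_fun setT a -> (forall y, (0 <= a y)%R) ->
    measurable_fun setT b -> (forall y, (0 <= b y)%R) ->
    sqr_integral a < +oo -> sqr_integral b < +oo ->
    direction_form nu k a b \is a fin_num.
  move=> ma a0 mb b0 aoo boo.
  rewrite ge0_fin_numE; first exact: direction_form_lty.
  exact: direction_form_ge0.
have sub_ge0 (r : R) (a b b' c : \bar R) : (0 <= r)%R -> a \is a fin_num ->
    b \is a fin_num -> c \is a fin_num -> b' = b -> b + b <= a + c ->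
    (0 <= (r * fine a - r * fine b') - (r * fine b - r * fine c))%R.
  move=> r0; case: a b c => [a| |]// [b| |]// [c| |]// _ _ _ ->.
  rewrite -!EFinD lee_fin /= => le.
  rewrite (_ : _ - _ = r * (a + c - (b + b)))%R; last by ring.
  by rewrite mulr_ge0// subr_ge0.
exact: (sub_ge0 _ _ _ _ _ q0 (fin _ _ mu_ u0 mu_ u0 uoo uoo)
  (fin _ _ mu_ u0 mv v0 uoo voo) (fin _ _ mv v0 mv v0 voo voo)
  (direction_formC nu mk k0 mv v0 mu_ u0)
  (direction_form_amgm nu mk k0 mu_ u0 mv v0)).
Qed.

Lemma hit_and_run_average_symmetric f g :
  measurable_fun setT f -> measurable_fun setT g ->
  sqr_integral f < +oo -> sqr_integral g < +oo ->
  (\int[mu]_x (T f x * g x * k x) = \int[mu]_x (f x * T g x * k x))%R.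
Proof.
move=> mf mg foo goo.
transitivity (\int[mu]_x (T g x * f x * k x))%R; last first.
  by apply: eq_Rintegral => x _; congr (_ * _)%R; rewrite mulrC.
rewrite (Rintegral_hit_and_run_average mg mf goo foo).
rewrite (Rintegral_hit_and_run_average mf mg foo goo).
exact: (direction_form_sub_sym (mpos mf) (funrpos_ge0 f) (mneg mf) (funrneg_ge0 f)
  (mpos mg) (funrpos_ge0 g) (mneg mg) (funrneg_ge0 g)).
Qed.

Lemma hit_and_run_average_positive f : measurable_fun setT f ->
  sqr_integral f < +oo -> (0 <= \int[mu]_x (T f x * f x * k x))%R.
Proof.
move=> mf foo; rewrite (Rintegral_hit_and_run_average mf mf foo foo).
exact: (direction_form_sub_ge0 (mpos mf) (funrpos_ge0 f) (mneg mf) (funrneg_ge0 f)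
  (pos_lty mf foo) (neg_lty mf foo)).
Qed.

End hit_and_run_form.

(** * Finiteness of the surface measure of the sphere *)

Section sphere.
Local Open Scope ereal_scope.
Context (R : realType).
Local Notation RT := (measurableTypeR R).
Local Notation lam := (@lebesgue_measure R).

Local Notation ball n :=
  ([set x | (\sum_(i < n) x ord0 i ^+ 2 <= 1)%R] : set 'rV[R]_n).

Let measurable_ball n : measurable (ball n).
Proof.
rewrite (_ : ball n =
    (fun x : 'rV[R]_n => \sum_(i < n) x ord0 i ^+ 2 : RT)%R @^-1` `]-oo, 1%R]%classic).
  rewrite -[X in measurable X]setTI.
  have ms : measurable_fun setT
      (fun x : 'rV[R]_n => \sum_(i < n) x ord0 i ^+ 2 : RT)%R.
    by apply: measurable_sum => i; apply: measurable_funX; exact: measurable_coord.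
  exact: ms.
by apply/seteqP; split => x /=; rewrite in_itv.
Qed.

(** The ball of dimension n + 1 lies in the product of [-1, 1] with the ball of dimension n. *)
Let borel_lebesgue_ball n : borel_lebesgue R n (ball n) < +oo.
Proof.
elim: n => [|n IH].
  rewrite /= /dirac /=; apply: (@le_lt_trans _ _ 1); last exact: ltry.
  by rewrite lee_fin indicE; case: (_ \in _).
rewrite (_ : borel_lebesgue R n.+1 _ = (lam \x borel_lebesgue R n)
  ((fun p : RT * 'rV[R]_n => row_mx (p.1)%:M p.2 : 'rV[R]_n.+1) @^-1` ball n.+1))//.
apply: (@le_lt_trans _ _ ((lam \x borel_lebesgue R n)
    (`[(-1)%R, 1%R]%classic `*` ball n))).
  apply: (@le_measure _ _ _ (lam \x borel_lebesgue R n)); rewrite ?inE.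
  - rewrite -[X in measurable X]setTI.
    by apply: measurable_row_mx => //; exact: measurable_ball.
  - by apply: measurableX; [exact: measurable_itv|exact: measurable_ball].
  - move=> [s y] /=; rewrite big_ord_recl.
    have -> : (row_mx s%:M y : 'rV[R]_n.+1) ord0 ord0 = s.
      transitivity ((s%:M : 'M[R]_1) ord0 ord0); last by rewrite mxE.
      by rewrite -[RHS](row_mxEl _ y); congr (row_mx _ _ _ _); exact: val_inj.
    have -> : (\sum_(i < n) (row_mx s%:M y : 'rV[R]_n.+1) ord0 (lift ord0 i) ^+ 2 =
        \sum_(i < n) y ord0 i ^+ 2)%R.
      apply: eq_bigr => i _; congr (_ ^+ 2)%R.
      by rewrite -[RHS](row_mxEr s%:M); congr (row_mx _ _ _ _); exact: val_inj.
    have S0 : (0 <= \sum_(i < n) y ord0 i ^+ 2)%R.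
      by apply: sumr_ge0 => i _; exact: sqr_ge0.
    have s0 := sqr_ge0 s => le1; split; last by lra.
    by rewrite in_itv /= -ler_norml -(@expr_le1 _ 2)// real_normK ?num_real//; lra.
rewrite product_measure1E//; last exact: measurable_ball.
apply: lte_mul_pinfty => //.
  by rewrite /= lebesgue_measure_itv/=; case: ifP.
Qed.

(** The total mass is n times the volume of the punctured unit ball. *)
Lemma borel_surface_finite n : @borel_surface R n setT < +oo.
Proof.
rewrite /borel_surface /mscale /= lte_mul_pinfty// ?lee_fin//.
rewrite /cone_volume /pushforward /= preimage_setT /mrestr setTI.
apply: le_lt_trans (borel_lebesgue_ball n); apply: le_measure; rewrite ?inE.
- exact: measurable_punctured_ball.
- exact: measurable_ball.
- move=> x /= /andP[_]; rewrite /enorm => le1.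
  rewrite -[X in (X <= _)%R]sqr_sqrtr.
    by rewrite exprn_ile1// sqrtr_ge0.
  by apply: sumr_ge0 => i _; exact: sqr_ge0.
Qed.

Lemma measurable_esphere n : measurable (esphere R n).
Proof.
rewrite (_ : esphere R n = @enorm R n @^-1` [set 1%R]).
  by rewrite -[X in measurable X]setTI; apply: measurable_enorm.
by apply/seteqP; split.
Qed.

(** The surface measure as a finite Borel measure on the whole space, the form in which Tonelli is
    applied; [surface] lives on the completed sigma-algebra. *)
Definition sphere_measure n := mrestr (@borel_surface R n) (@measurable_esphere n).

HB.instance Definition _ n := Measure.on (@sphere_measure n).

Let sphere_measure_fin_num n : fin_num_fun (@sphere_measure n).
Proof.
move=> A mA; rewrite ge0_fin_numE//; apply: le_lt_trans (borel_surface_finite n).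
by rewrite /sphere_measure /mrestr; apply: le_measure; rewrite ?inE//;
  apply: measurableI => //; exact: measurable_esphere.
Qed.

HB.instance Definition _ n :=
  @Measure_isFinite.Build _ _ _ (@sphere_measure n) (@sphere_measure_fin_num n).

End sphere.

(** * From the completed measures to the Borel ones *)

Section surface_integral.
Local Open Scope ereal_scope.
Context (R : realType) (n : nat).
Local Notation S := (esphere R n).
Local Notation nu := (@sphere_measure R n).

Lemma surface_esphere : surface S = nu setT.
Proof.
rewrite /sphere_measure /mrestr setTI.
exact: (completed_measure_extensionE (@borel_surface R n) (@measurable_esphere R n)).
Qed.

(** A null set of [sphere_measure] is one that meets the sphere in a null set of [borel_surface], so
    the comparison with the completion is made for functions cut off outside the sphere. *)
Lemma integral_surface (phi : 'rV[R]_n -> \bar R) (g : 'rV[R]_n -> \bar R)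
    (N : set 'rV[R]_n) :
  measurable_fun setT g -> measurable N -> nu N = 0 ->
  (forall th, ~ N th -> phi th = g th) ->
  \int[surface]_(th in S) phi th = \int[nu]_th g th.
Proof.
move=> mg mN N0 phiE; have mS := @measurable_esphere R n.
rewrite integral_mkcond.
transitivity (\int[@borel_surface R n]_th (g \_ S) th).
  apply: (integral_completed (@measurable_id_completion _ _ _ (@borel_surface R n))
    (@completed_measure_extension_complete _ _ _ (@borel_surface R n)) _ _ (N := N `&` S)) => //.
  - by move=> A mA; exact: completed_measure_extensionE.
  - apply/(measurable_restrictT g mS); exact: measurable_funS mg.
  - exact: measurableI.
  - move=> th NSth; rewrite !patchE; case: ifPn => // /set_mem Sth.
    by apply: phiE => Nth; exact: NSth.
rewrite -integral_mkcond.
transitivity (\int[nu]_(th in S) g th).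
  apply: eq_measure_integral => A mA AS.
  by rewrite -[RHS]/(borel_surface (A `&` S)) setIidl.
rewrite integral_mkcond; apply: ae_eq_integral => //.
  apply/(measurable_restrictT g mS); exact: measurable_funS mg.
exists (~` S); split; first exact: measurableC.
  by rewrite -[LHS]/(borel_surface (~` S `&` S)) setICl measure0.
move=> th /=; apply: contra_not => Sth _; rewrite patchE mem_set//.
Qed.

End surface_integral.

Lemma integral_completed_lebesgue (R : realType) (phi : R -> \bar R)
    (g : measurableTypeR R -> \bar R) (N : set (measurableTypeR R)) :
  measurable_fun setT g -> measurable N -> lebesgue_measure N = 0%E ->
  (forall s, ~ N s -> phi s = g s) ->
  (\int[completed_lebesgue_measure]_s phi s = \int[lebesgue_measure]_s g s)%E.
Proof.
move=> mg mN N0 phiE.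
pose cR := caratheodory_type (mu_ext (wlength (idfun : R -> R))).
apply: (@integral_completed _ _ cR (measurableTypeR R) R
  completed_lebesgue_measure lebesgue_measure id phi g N) => //.
- by move=> _ A mA; rewrite setTI; exact: sub_caratheodory.
- exact: completed_lebesgue_measure_is_complete.
Qed.

(** * Almost every chord through almost every point meets a null set in a null set *)

Section null_chords.
Local Open Scope ereal_scope.
Context (R : realType) (n : nat).
Local Notation V := 'rV[R]_n.
Local Notation RT := (measurableTypeR R).
Local Notation lam := (@lebesgue_measure R).
Local Notation mu := (borel_lebesgue R n).
Variable nu : {sigma_finite_measure set V -> \bar R}.

Lemma null_set_neq0 d (T : measurableType d) (m : {measure set T -> \bar R})
    (F : T -> \bar R) :
  measurable_fun setT F -> (forall x, 0 <= F x) -> \int[m]_x F x = 0 ->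
  measurable [set x | F x != 0] /\ m [set x | F x != 0] = 0.
Proof.
move=> mF F0 IF0.
have mN : measurable [set x | F x != 0].
  by have := emeasurable_neq measurableT mF 0; rewrite setTI.
split=> //; have [N [mN' N0 sub]] : ae_eq m setT F (cst 0).
  apply/ae_eq_integral_abs => //.
  by under eq_integral => x _ do rewrite gee0_abs//.
apply: (subset_measure0 mN mN' _ N0) => x /= Fx; apply: sub => /=.
by move/(_ I) => Fx0; move: Fx; rewrite Fx0 eqxx.
Qed.

(** For fixed direction and parameter, moving along the line is a translation of the space, so by
    Tonelli the integral of the indicator of [N] over points, directions and parameters is 0.
    Vanishing almost everywhere is then extracted first in the point and afterwards in the
    direction. *)
Lemma null_chords (N : set V) : measurable N -> mu N = 0 ->
  exists N' : set V, [/\ measurable N', mu N' = 0 &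
    forall x, ~ N' x -> exists M : set V, [/\ measurable M, nu M = 0 &
      forall th, ~ M th -> lam [set s : RT | N (x + (s : R) *: th)%R] = 0]].
Proof.
move=> mN N0.
have m1 : measurable_fun setT (\1_N : V -> RT) by exact: measurable_indic.
have i0 y : (0 <= \1_N y :> R)%R by [].
have mL := measurable_line_integral m1.
have L0 x th : 0 <= line_integral (\1_N) x th by exact: line_integral_ge0.
have LE x th : line_integral (\1_N) x th = lam [set s : RT | N (x + (s : R) *: th)%R].
  rewrite line_integralE -[RHS]/(lam ((fun s : RT => (x + (s : R) *: th)%R) @^-1` N)).
  rewrite -[X in lam X]setIT -integral_indic//.
  rewrite -[X in measurable X]setTI.
  apply: (measurable_fun_pair2 (x, th) (@measurable_lineT R n)) => //.
have I0 th : \int[mu]_x line_integral (\1_N) x th = 0.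
  rewrite (_ : \int[mu]_x _ = \int[mu]_x \int[lam]_s (\1_N (x + (s : R) *: th)%R)%:E)//.
  rewrite (@fubini_tonelli _ _ _ _ _ mu lam (fun p : V * RT =>
    (\1_N (p.1 + (p.2 : R) *: th)%R)%:E)); first last.
  - by move=> p; rewrite lee_fin.
  - apply/measurable_EFinP; apply: (measurableT_comp m1).
    apply: (measurableT_comp (@measurable_lineT R n)
      (g := fun p : V * RT => ((p.1, th), p.2))).
    apply/measurable_fun_pairP; split; last exact: measurable_snd.
    by apply/measurable_fun_pairP; split; [exact: measurable_fst|exact: measurable_cst].
  rewrite integral0_eq// => s _.
  rewrite (@ge0_integral_borel_lebesgue_translate R n
    (fun x => (\1_N x)%:E) ((s : R) *: th)%R).
  - by rewrite integral_indic// setIT.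
  - exact/measurable_EFinP.
  - by move=> x; rewrite lee_fin.
pose F x := \int[nu]_th line_integral (\1_N) x th.
have mF : measurable_fun setT F.
  by apply: (@measurable_fun_fubini_tonelli_F _ _ _ _ _ nu
    (fun p : V * V => line_integral (\1_N) p.1 p.2)).
have F0 x : 0 <= F x by apply: integral_ge0.
have IF0 : \int[mu]_x F x = 0.
  rewrite (@fubini_tonelli _ _ _ _ _ mu nu
    (fun p : V * V => line_integral (\1_N) p.1 p.2))//.
  by rewrite integral0_eq// => th _; exact: I0.
have [mN' N'0] := null_set_neq0 mF F0 IF0.
exists [set x | F x != 0]; split => // x /negP/negPn/eqP Fx0.
have [mM M0] := null_set_neq0 (measurable_fun_pair2 x mL) (L0 x) Fx0.
exists [set th | line_integral (\1_N) x th != 0]; split => // th.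
by move=> /negP/negPn/eqP; rewrite LE.
Qed.

End null_chords.

(** * Borel representatives of the hit-and-run operator *)

Section hit_and_run_borel.
Local Open Scope ereal_scope.
Context (R : realType) (n : nat).
Local Notation V := 'rV[R]_n.
Local Notation RT := (measurableTypeR R).
Local Notation lam := (@lebesgue_measure R).
Local Notation mu := (borel_lebesgue R n).
Local Notation nu := (@sphere_measure R n).
Variables (K : set V) (rho f g k : V -> R) (N : set V).
Hypotheses (mk : measurable_fun setT k) (k0 : forall y, (0 <= k y)%R).
Hypotheses (mg : measurable_fun setT g) (mN : measurable N) (N0 : mu N = 0).
Hypothesis kE : forall x, ~ N x -> ((rho \_ K) x = k x)%R.
Hypothesis fE : forall x, ~ N x -> (f x * (rho \_ K) x = g x * k x)%R.

Let integral_chord (F : V -> R) (G : V -> R) x th :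
  measurable_fun setT G ->
  (forall y, ~ N y -> ((F \_ K) y = G y)%R) ->
  lam [set s : RT | N (x + (s : R) *: th)%R] = 0 ->
  \int[completed_lebesgue_measure]_(s in chord K x th)
    (F (x + (s : R) *: th)%R)%:E = line_integral G x th.
Proof.
move=> mG FG N0'; rewrite integral_mkcond line_integralE.
have mN' : measurable [set s : RT | N (x + (s : R) *: th)%R].
  rewrite -[X in measurable X]setTI.
  by apply: (measurable_fun_pair2 (x, th) (@measurable_lineT R n)).
apply: (integral_completed_lebesgue _ mN' N0').
  by apply/measurable_EFinP; exact: measurable_line_fun.
move=> s Ns; rewrite -(FG _ Ns) !patchE.
have -> : (s \in chord K x th) = ((x + (s : R) *: th)%R \in K).
  by apply/idP/idP => /set_mem H; apply/mem_set.
by case: ifP.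
Qed.

(** [f] enters the operator only through its product with the density. Comparing products lets [g]
    differ from [f] wherever the density vanishes, as independence of the representative
    requires. *)
Lemma hit_and_run_borel : exists N' : set V, [/\ measurable N', mu N' = 0 &
  forall x, ~ N' x -> hit_and_run K rho f x = hit_and_run_average nu k g x].
Proof.
have [N' [mN' N'0 NP]] := null_chords nu mN N0.
exists N'; split => // x /NP [M [mM M0 MP]].
rewrite /hit_and_run /hit_and_run_average surface_esphere.
congr (_ * fine _)%R; apply: (integral_surface _ mM M0).
  exact: measurable_chord_average1.
move=> th /MP Nx; congr _%:E; rewrite /chord_average /chord_scale.
congr ((fine _)^-1 * fine _)%R.
  by apply: integral_chord => //.
apply: (@integral_chord (fun y => f y * rho y)%R) => //.
  exact: measurable_funM.
move=> y Ny; rewrite -[RHS](fE Ny) !patchE.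
by case: ifP => //; rewrite mulr0.
Qed.

End hit_and_run_borel.

Lemma gt0_muleBr (R : realDomainType) (r : R) (x y : \bar R) : 0 < r ->
  (0 <= x)%E -> (0 <= y)%E -> (r%:E * (x - y) = r%:E * x - r%:E * y)%E.
Proof.
move=> r0; case: x => [x| |]//; case: y => [y| |]// _ _.
- by rewrite -EFinB -!EFinM -EFinB mulrBr.
- by rewrite /= gt0_muley ?lte_fin// gt0_muleNy ?lte_fin.
- by rewrite /= gt0_muley ?lte_fin.
- by rewrite /= gt0_muley ?lte_fin// gt0_muleNy ?lte_fin.
Qed.

Lemma fine_gt0_mule (R : realDomainType) (r : R) (x : \bar R) : 0 < r ->
  fine (r%:E * x)%E = r * fine x.
Proof.
move=> r0; case: x => [x| |]//.
  by rewrite gt0_muley ?lte_fin//= mulr0.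
by rewrite gt0_muleNy ?lte_fin//= mulr0.
Qed.

Lemma null_setU d (T : measurableType d) (R : realType)
    (m : {measure set T -> \bar R}) (A B : set T) : measurable A -> measurable B ->
  m A = 0%E -> m B = 0%E -> m (A `|` B) = 0%E.
Proof.
move=> mA mB A0 B0; apply/eqP; rewrite eq_le measure_ge0 andbT.
by rewrite -[leRHS]adde0 -{1}A0 -B0; exact: measureU2.
Qed.

(** * Square-integrable functions *)

Section Lfun2.
Context d (T : measurableType d) (R : realType) (m : {measure set T -> \bar R}).

Lemma Lnorm2E (f : T -> R) :
  ('N[m]_2%:E [EFin \o f] = (\int[m]_x (f x ^+ 2)%:E) `^ 2^-1)%E.
Proof.
rewrite unlock; congr (_ `^ _)%E; apply: eq_integral => x _ /=.
by rewrite powR_mulrn// real_normK ?num_real.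
Qed.

Lemma Lfun2P (f : T -> R) : f \in Lfun m 2%:E <->
  measurable_fun setT f /\ (\int[m]_x (f x ^+ 2)%:E < +oo)%E.
Proof.
split => [f2|[mf foo]].
  split.
    by move: f2; rewrite inE => /andP[+ _]; rewrite inE.
  have /integrableP[_] := Lfun2_integrable_sqr f2.
  by under eq_integral => x _ do rewrite /= ger0_norm ?sqr_ge0//.
rewrite inE; apply/andP; split; rewrite inE//=.
by rewrite /finite_norm Lnorm2E poweR_lty.
Qed.

End Lfun2.

(** * The operator on square-integrable functions for [pi] *)

Section L2_hit_and_run.
Local Open Scope ereal_scope.
Context (R : realType) (n : nat).
Local Notation V := 'rV[R]_n.
Local Notation cV := (lebesgue_rV R n).
Local Notation RT := (measurableTypeR R).
Local Notation mu := (borel_lebesgue R n).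
Local Notation leb := (@lebesgue R n).
Local Notation nu := (@sphere_measure R n).

Variables (K : set cV) (rho : cV -> R) (pi : probability cV R) (Z : R).
Variables (k : V -> R) (Nk : set V).
Hypotheses (Z0 : (0 < Z)%R).
Hypotheses (mk : measurable_fun setT k) (k0 : forall y, (0 <= k y)%R).
Hypotheses (mNk : measurable Nk) (Nk0 : mu Nk = 0).
Hypothesis kE : forall x : V, ~ Nk x -> ((rho \_ K) x = k x)%R.
Hypothesis mh : measurable_fun setT (rho \_ K)%R.
Hypothesis h0 : forall x, (0 <= (rho \_ K) x)%R.
Hypothesis piE : forall A, measurable A ->
  pi A = \int[leb]_(x in A) ((rho \_ K) x / Z)%:E.

Local Notation T := (hit_and_run_average nu k).
Local Notation P := (hit_and_run K rho).

Let Zi0 : (0 < Z^-1)%R. Proof. by rewrite invr_gt0. Qed.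

Let idm : measurable_fun setT (id : cV -> V).
Proof. exact: measurable_id_completion. Qed.

Let cleb : measure_is_complete leb.
Proof. exact: completed_measure_extension_complete. Qed.

Let lebE (A : set V) : measurable A -> leb (id @^-1` A) = mu A.
Proof. by move=> mA; exact: completed_measure_extensionE. Qed.

Lemma measurable_fun_lebesgue (phi : cV -> \bar R) (g : V -> \bar R) (N : set V) :
  measurable_fun setT g -> measurable N -> mu N = 0 ->
  (forall x : V, ~ N x -> phi x = g x) -> measurable_fun setT phi.
Proof.
move=> mg mN N0 phiE.
exact: (measurable_fun_completed idm cleb lebE mg mN N0 phiE).
Qed.

Lemma ge0_integral_pi (phi : cV -> \bar R) (g : V -> \bar R) (N : set V) :
  measurable_fun setT g -> measurable N -> mu N = 0 ->
  (forall x : V, ~ N x -> phi x = g x) ->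
  (forall x, 0 <= phi x) -> (forall x, 0 <= g x) ->
  \int[pi]_x phi x = (Z^-1)%:E * \int[mu]_x (g x * (k x)%:E).
Proof.
move=> mg mN N0 phiE phi0 g0.
have mphi := measurable_fun_lebesgue mg mN N0 phiE.
have mw : measurable_fun setT (fun x : cV => (rho \_ K) x / Z : RT)%R.
  by apply: measurable_funM; [exact: mh|exact: measurable_cst].
have w0 x : (0 <= (rho \_ K) x / Z)%R by rewrite divr_ge0// ltW.
have mkE : measurable_fun setT (fun x => (k x)%:E) by exact/measurable_EFinP.
have mgk := emeasurable_funM mg mkE.
have gk0 x : 0 <= g x * (k x)%:E by apply: mule_ge0; [exact: g0|rewrite lee_fin].
transitivity (\int[leb]_x (phi x * ((rho \_ K) x / Z)%:E)).
  exact: (ge0_integral_density mw w0 piE mphi phi0).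
transitivity (\int[mu]_x ((Z^-1)%:E * (g x * (k x)%:E))).
  have mZ : measurable_fun setT (fun x : V => (Z^-1)%:E * (g x * (k x)%:E)).
    by apply: emeasurable_funM; [exact: measurable_cst|exact: mgk].
  apply: (ge0_integral_completed idm cleb lebE mZ (measurableU _ _ mN mNk)
    (null_setU mN mNk N0 Nk0)).
  - move=> x /not_orP[Nx Nkx]; rewrite (phiE _ Nx) (kE Nkx) EFinM.
    by rewrite [RHS]muleC -muleA.
  - by move=> x; apply: mule_ge0; [exact: phi0|rewrite lee_fin].
  - by move=> x; apply: mule_ge0; [rewrite lee_fin ltW|exact: gk0].
apply: ge0_integralZl; first exact: measurableT.
- exact: mgk.
- by move=> x _; exact: gk0.
- by rewrite lee_fin ltW.
Qed.

(** A positive constant distributes over the difference of the positive and negative integrals even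
    when these are infinite, so the formula also covers divergent integrals. *)
Lemma integral_pi (phi : cV -> R) (g : V -> R) (N : set V) :
  measurable_fun setT g -> measurable N -> mu N = 0 ->
  (forall x : V, ~ N x -> phi x = g x) ->
  \int[pi]_x (phi x)%:E = (Z^-1)%:E * \int[mu]_x (g x * k x)%:E.
Proof.
move=> mg mN N0 phiE; rewrite integralE [in RHS]integralE.
have mgE : measurable_fun setT (EFin \o g) by exact/measurable_EFinP.
rewrite gt0_muleBr//; [|by apply: integral_ge0..].
congr (_ - _).
- rewrite (@ge0_integral_pi _ (EFin \o g)^\+ N)//.
  + congr (_ * _); apply: eq_integral => x _; rewrite !funeposE /=.
    by rewrite muleC maxe_pMr ?lee_fin// mule0 -EFinM mulrC.
  + exact: measurable_funepos.
  + by move=> x Nx; rewrite !funeposE /= phiE.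
- rewrite (@ge0_integral_pi _ (EFin \o g)^\- N)//.
  + congr (_ * _); apply: eq_integral => x _; rewrite !funenegE /=.
    by rewrite muleC maxe_pMr ?lee_fin// mule0 -EFinM mulrN mulrC.
  + exact: measurable_funeneg.
  + by move=> x Nx; rewrite !funenegE /= phiE.
Qed.

Lemma Rintegral_pi (phi : cV -> R) (g : V -> R) (N : set V) :
  measurable_fun setT g -> measurable N -> mu N = 0 ->
  (forall x : V, ~ N x -> phi x = g x) ->
  (\int[pi]_x phi x = Z^-1 * \int[mu]_x (g x * k x))%R.
Proof.
move=> mg mN N0 phiE; rewrite -fine_gt0_mule//; congr fine.
exact: (integral_pi mg mN N0 phiE).
Qed.

(** The zero set of [k] is null for [pi], so it may be added to the exceptional set. *)
Lemma ae_pi (Q : cV -> Prop) (N : set V) : measurable N -> mu N = 0 ->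
  (forall x : V, ~ N x -> k x != 0%R -> Q x) -> {ae pi, forall x, Q x}.
Proof.
move=> mN N0 NQ.
pose A : set V := N `|` k @^-1` [set 0%R].
have mA : measurable A.
  apply: measurableU; first exact: mN.
  by rewrite -[X in measurable X]setTI; apply: mk => //; exact: measurable_set1.
have cA : measurable (A : set cV) by exact: caratheodory_measurable_mu_ext.
exists A; split; first exact: cA.
  transitivity (\int[pi]_x (\1_A x)%:E); first by rewrite integral_indic// setIT.
  have m1 : measurable_fun setT (\1_A : V -> RT) by exact: measurable_indic.
  rewrite (@integral_pi (\1_A) (\1_A) set0 m1 measurable0 (measure0 mu))//.
  rewrite (_ : \int[mu]_x _ = 0) ?mule0//.
  transitivity (\int[mu]_x cst 0 x); last by rewrite integral0.
  apply: ae_eq_integral => //.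
    by apply/measurable_EFinP; exact: measurable_funM.
  exists N; split => // x /=; apply: contra_notP => Nx _.
  rewrite indicE; have [/set_mem[//|/= ->]|_] := boolP (x \in A).
    by rewrite mulr0.
  by rewrite mul0r.
move=> x; apply: contra_notP => Ax; apply: NQ => [Nx|].
  by apply: Ax; left.
by apply/eqP => kx; apply: Ax; right.
Qed.

Lemma borel_version_L2 (f : cV -> R) : f \in Lfun pi 2%:E ->
  exists (g : V -> R) (N : set V), [/\ measurable_fun setT g, measurable N, mu N = 0,
    (forall x : V, ~ N x -> f x = g x) & \int[mu]_x (g x ^+ 2 * k x)%:E < +oo].
Proof.
move=> /Lfun2P[mf foo].
have [g [N [mg mN N0 fg _]]] := completion_borel_version (sigma_finiteT mu) mf.
exists g, N; split => //.
have mg2 : measurable_fun setT (fun x => g x ^+ 2 : RT)%R by exact: measurable_funX.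
have E : \int[pi]_x (f x ^+ 2)%:E = (Z^-1)%:E * \int[mu]_x (g x ^+ 2 * k x)%:E.
  by apply: (integral_pi mg2 mN N0) => x Nx; rewrite fg.
move: foo; rewrite E ltey; apply: contraPT; rewrite ltey negbK => /eqP ->.
by rewrite gt0_muley ?lte_fin.
Qed.

Lemma hit_and_run_pi (f : cV -> R) (g : V -> R) (N : set V) :
  measurable_fun setT g -> measurable N -> mu N = 0 ->
  (forall x : V, ~ N x -> (f x * (rho \_ K) x = g x * (rho \_ K) x)%R) ->
  exists N' : set V, [/\ measurable N', mu N' = 0 & forall x : V, ~ N' x -> P f x = T g x].
Proof.
move=> mg mN N0 fg.
apply: (@hit_and_run_borel R n K rho f g k (N `|` Nk)) => //.
- exact: measurableU.
- exact: null_setU.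
- by move=> x /not_orP[_ Nx]; exact: kE.
- by move=> x /not_orP[Nx Nkx]; rewrite fg// (kE Nkx).
Qed.

Lemma L2_hit_and_run_repr (f : cV -> R) : f \in Lfun pi 2%:E ->
  exists (g : V -> R) (N : set V), [/\ measurable_fun setT g,
    measurable N /\ mu N = 0, (forall x : V, ~ N x -> f x = g x),
    (forall x : V, ~ N x -> P f x = T g x) & \int[mu]_x (g x ^+ 2 * k x)%:E < +oo].
Proof.
move=> /borel_version_L2[g [N [mg mN N0 fg goo]]].
have fgh (x : V) : ~ N x -> (f x * (rho \_ K) x = g x * (rho \_ K) x)%R.
  by move=> Nx; rewrite fg.
have [N' [mN' N'0 PT]] := hit_and_run_pi mg mN N0 fgh.
exists g, (N `|` N'); split => //.
- by split; [exact: measurableU|exact: null_setU].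
- by move=> x /not_orP[Nx _]; exact: fg.
- by move=> x /not_orP[_ Nx]; exact: PT.
Qed.

Let measurable_T g : measurable_fun setT g -> measurable_fun setT (T g : V -> RT).
Proof. by move=> mg; exact: measurable_hit_and_run_average. Qed.

Let Lfun_hit_and_run (f : cV -> R) : f \in Lfun pi 2%:E -> P f \in Lfun pi 2%:E.
Proof.
move=> /L2_hit_and_run_repr[g [N [mg [mN N0] _ PT goo]]].
have mTg := measurable_T mg.
have mTg2 : measurable_fun setT (fun x => T g x ^+ 2 : RT)%R by exact: measurable_funX.
apply/Lfun2P; split.
  apply/measurable_EFinP; apply: (@measurable_fun_lebesgue _ (EFin \o T g) N) => //.
    exact/measurable_EFinP.
  by move=> x Nx /=; rewrite PT.
have -> : \int[pi]_x (P f x ^+ 2)%:E = (Z^-1)%:E * \int[mu]_x (T g x ^+ 2 * k x)%:E.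
  by apply: (integral_pi mTg2 mN N0) => x Nx; rewrite PT.
apply: lte_mul_pinfty => //; first by rewrite lee_fin ltW.
exact: le_lt_trans (hit_and_run_average_contraction nu mk k0 mg) goo.
Qed.

(** A [pi]-null set may carry Lebesgue measure where the density vanishes, so [f] and [f'] need not
    share a Borel version. Still |g - g'| k vanishes Lebesgue almost everywhere; hence [g] and [f']
    have the same product with the density off a null set, and [T g] represents the image of [f']
    too. *)
Let hit_and_run_ae (f f' : cV -> R) : f \in Lfun pi 2%:E -> f' \in Lfun pi 2%:E ->
  f = f' %[ae pi] -> P f = P f' %[ae pi].
Proof.
move=> f2 f'2 ff'.
have [g [N [mg [mN N0] fg PT _]]] := L2_hit_and_run_repr f2.
have [g' [N' [mg' [mN' N'0] f'g' _ _]]] := L2_hit_and_run_repr f'2.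
have [[mf _] [mf' _]] := ((Lfun2P pi f).1 f2, (Lfun2P pi f').1 f'2).
have md : measurable_fun setT (fun x => `|g x - g' x|%R : RT).
  by apply: measurableT_comp => //; exact: measurable_funB.
have I0 : \int[mu]_x (`|g x - g' x| * k x)%:E = 0.
  have : \int[pi]_x (`|f x - f' x|%R)%:E = 0.
    have mff' : measurable_fun setT (fun x => (f x - f' x)%:E).
      by apply/measurable_EFinP; exact: measurable_funB.
    apply/(ae_eq_integral_abs pi measurableT mff').
    by apply: filterS ff' => x ff'x _; rewrite ff'x// subrr.
  have -> : \int[pi]_x (`|f x - f' x|%R)%:E =
      (Z^-1)%:E * \int[mu]_x (`|g x - g' x| * k x)%:E.
    apply: (integral_pi md (measurableU _ _ mN mN') (null_setU mN mN' N0 N'0)).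
    by move=> x /not_orP[Nx N'x]; rewrite fg// f'g'.
  by move/eqP; rewrite mule_eq0 eqe gt_eqF//= => /eqP.
have mdk : measurable_fun setT (fun x => (`|g x - g' x| * k x)%:E).
  by apply/measurable_EFinP; exact: measurable_funM.
have dk0 x : 0 <= (`|g x - g' x| * k x)%:E by rewrite lee_fin mulr_ge0.
have [] := null_set_neq0 mdk dk0 I0.
set M := [set x | _] => mM M0.
have mN1 : measurable ((N' `|` Nk) `|` M) by do 2 apply: measurableU => //.
have N10 : mu ((N' `|` Nk) `|` M) = 0.
  by apply: null_setU => //; [exact: measurableU|exact: null_setU].
have f'gh (x : V) : ~ ((N' `|` Nk) `|` M) x ->
    (f' x * (rho \_ K) x = g x * (rho \_ K) x)%R.
  move=> /not_orP[/not_orP[N'x Nkx] /negP/negPn/eqP[]].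
  rewrite f'g'// (kE Nkx) => /eqP; rewrite mulf_eq0 => /orP[|/eqP ->].
    by rewrite normr_eq0 subr_eq0 => /eqP ->.
  by rewrite !mulr0.
have [N2 [mN2 N20 PT']] := hit_and_run_pi mg mN1 N10 f'gh.
apply: (ae_pi (measurableU _ _ mN mN2) (null_setU mN mN2 N0 N20)).
by move=> x /not_orP[Nx N2x] _ _; rewrite PT// PT'.
Qed.

Let hit_and_run_linear (a : R) (f f' : cV -> R) :
  f \in Lfun pi 2%:E -> f' \in Lfun pi 2%:E ->
  P (fun x => a * f x + f' x)%R = (fun x => a * P f x + P f' x)%R %[ae pi].
Proof.
move=> /L2_hit_and_run_repr[g [N [mg [mN N0] fg PT goo]]].
move=> /L2_hit_and_run_repr[g' [N' [mg' [mN' N'0] f'g' PT' g'oo]]].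
have mN1 := measurableU _ _ mN mN'; have N10 := null_setU mN mN' N0 N'0.
have magg : measurable_fun setT (fun x => a * g x + g' x : RT)%R.
  by apply: measurable_funD => //; exact: measurable_funM.
have agg (x : V) : ~ (N `|` N') x -> ((a * f x + f' x) * (rho \_ K) x =
    (a * g x + g' x) * (rho \_ K) x)%R.
  by move=> /not_orP[Nx N'x]; rewrite fg// f'g'.
have [N2 [mN2 N20 PTa]] := hit_and_run_pi magg mN1 N10 agg.
have [M [mM M0 sub]] := ae_hit_and_run_average_linear nu mk k0 a mg mg' goo g'oo.
apply: (@ae_pi _ ((N `|` N') `|` (N2 `|` M))).
- by apply: measurableU => //; exact: measurableU.
- by apply: null_setU => //; [exact: measurableU|exact: null_setU].
move=> x /not_orP[/not_orP[Nx N'x] /not_orP[N2x Mx]] kn0 _.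
rewrite PTa// PT// PT'//; apply: contrapT => neq; apply: Mx; apply: sub => /= lin.
by apply: neq; exact: lin.
Qed.

Let hit_and_run_norm (f : cV -> R) : f \in Lfun pi 2%:E ->
  'N[pi]_2%:E [EFin \o P f] <= 1%:E * 'N[pi]_2%:E [EFin \o f].
Proof.
move=> /L2_hit_and_run_repr[g [N [mg [mN N0] fg PT goo]]].
have mTg2 : measurable_fun setT (fun x => T g x ^+ 2 : RT)%R.
  by apply: measurable_funX; exact: measurable_T.
have mg2 : measurable_fun setT (fun x => g x ^+ 2 : RT)%R by exact: measurable_funX.
rewrite mul1e !Lnorm2E; apply: gt0_ler_poweR; first by rewrite invr_ge0.
- by rewrite in_itv/= leey andbT integral_ge0// => x _; rewrite lee_fin sqr_ge0.
- by rewrite in_itv/= leey andbT integral_ge0// => x _; rewrite lee_fin sqr_ge0.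
have -> : \int[pi]_x (P f x ^+ 2)%:E = (Z^-1)%:E * \int[mu]_x (T g x ^+ 2 * k x)%:E.
  by apply: (integral_pi mTg2 mN N0) => x Nx; rewrite PT.
have -> : \int[pi]_x (f x ^+ 2)%:E = (Z^-1)%:E * \int[mu]_x (g x ^+ 2 * k x)%:E.
  by apply: (integral_pi mg2 mN N0) => x Nx; rewrite fg.
apply: lee_wpmul2l; first by rewrite lee_fin ltW.
exact: (hit_and_run_average_contraction nu mk k0 mg).
Qed.

Lemma hit_and_run_positive_operator : positive_operator pi P.
Proof.
split; [split; [split|]|].
- by move=> f f2; exact: Lfun_hit_and_run.
- by move=> f f' f2 f'2; exact: hit_and_run_ae.
- by move=> a f f' f2 f'2; exact: hit_and_run_linear.
- by exists 1%R => f f2; exact: hit_and_run_norm.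
- move=> f f' /L2_hit_and_run_repr[g [N [mg [mN N0] fg PT goo]]].
  move=> /L2_hit_and_run_repr[g' [N' [mg' [mN' N'0] f'g' PT' g'oo]]].
  have mN1 := measurableU _ _ mN mN'; have N10 := null_setU mN mN' N0 N'0.
  have m1 : measurable_fun setT (fun x => T g x * g' x : RT)%R.
    by apply: measurable_funM => //; exact: measurable_T.
  have m2 : measurable_fun setT (fun x => g x * T g' x : RT)%R.
    by apply: measurable_funM => //; exact: measurable_T.
  rewrite /L2_inner (Rintegral_pi m1 mN1 N10); last first.
    by move=> x /not_orP[Nx N'x]; rewrite PT// f'g'.
  rewrite (Rintegral_pi m2 mN1 N10); last first.
    by move=> x /not_orP[Nx N'x]; rewrite PT'// fg.
  by congr (_ * _)%R; exact: hit_and_run_average_symmetric.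
- move=> f /L2_hit_and_run_repr[g [N [mg [mN N0] fg PT goo]]].
  have m1 : measurable_fun setT (fun x => T g x * g x : RT)%R.
    by apply: measurable_funM => //; exact: measurable_T.
  rewrite /L2_inner (Rintegral_pi m1 mN N0); last first.
    by move=> x Nx; rewrite PT// fg.
  by apply: mulr_ge0; [exact: ltW|exact: hit_and_run_average_positive].
Qed.

End L2_hit_and_run.

(** * From the density on [K] to a Borel density on the whole space *)

Unset Implicit Arguments.

Theorem mainTheorem1 (R : realType) (d : nat) (K : set (lebesgue_rV R d))
    (rho : lebesgue_rV R d -> R) (pi : probability (lebesgue_rV R d) R) :
  (0 < d)%N ->
  measurable K ->
  (K : set 'rV[R]_d)° !=set0 ->
  (forall x, K x -> 0 <= rho x) ->
  lebesgue.-integrable K (EFin \o rho) ->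
  0 < \int[lebesgue]_(x in K) rho x ->
  (forall A, measurable A ->
    pi A = ((\int[lebesgue]_(x in A `&` K) rho x) /
            (\int[lebesgue]_(x in K) rho x))%:E) ->
  positive_operator pi (hit_and_run K rho).
Proof.
move=> _ mK _ rho0 irho; set Z := Rintegral _ _ _ => Z0 piE.
(* Extending the density by 0 outside [K] turns chord integrals into integrals over full lines. *)
have h0 x : 0 <= (rho \_ K) x.
  by rewrite patchE; case: ifPn => // /set_mem; exact: rho0.
have ih : lebesgue.-integrable setT (EFin \o (rho \_ K)).
  by have := (integrable_mkcond (EFin \o rho) mK).1 irho; rewrite restrict_EFin.
have mh : measurable_fun setT (rho \_ K).
  by apply/measurable_EFinP; exact: measurable_int ih.
have [k [N [mk mN N0 kE kN]]] :=
  completion_borel_version (sigma_finiteT (borel_lebesgue R d)) mh.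
(* Off [N] the version equals the extended density, and on [N] it is 0 by construction. *)
have k0 y : 0 <= k y.
  by have [Ny|Ny] := pselect (N y); [rewrite kN|rewrite -kE].
apply: (hit_and_run_positive_operator Z0 mk k0 mN N0 kE mh h0) => A mA.
rewrite piE//.
have ihA : lebesgue.-integrable A (EFin \o (rho \_ K)).
  exact: integrableS ih.
rewrite (_ : Rintegral _ _ _ = Rintegral lebesgue A (rho \_ K)); last first.
  by rewrite Rintegral_mkcondr.
rewrite -RintegralZr// /Rintegral fineK//.
by apply: integrable_fin_num => //; exact: (integrableZr mA Z^-1 ihA).
Qed.
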